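(* Let $(\phi_n^+)_{n\ge1}$ and $(\phi_n^-)_{n\ge1}$ be sequences of inner functions such that for every $r \in (0,1)$ there exist $\delta>0$ and $n_0$ with $|\phi_n^+(z) - i|\ge\delta$ and $|\phi_n^-(z)+i|\ge\delta$ for all $|z|\le r$ and $n\ge n_0$ (i.e., $\phi_n^+$ and $\phi_n^-$ are bounded away from $i$ and $-i$ respectively on $|z|\le r$ as $n\to\infty$). Then the product $$\prod_{n \geq 1} \frac{T(\phi_n^+)}{T(\phi_n^-)}$$ converges absolutely and locally uniformly on $\mathbb{D}$ if and only if $\sum_{n \geq 1} |\phi_n^+ - \phi_n^-|$ converges locally uniformly on $\mathbb{D}$.
   Context: $\mathbb{D}$ is the open unit disk. $T(z) = i\frac{1-iz}{1+iz}$ and $T(\phi)=T\circ\phi$. A product $\prod w_n$ of functions converges absolutely and locally uniformly on $\mathbb{D}$ if $\sum|1-w_n(z)|$ converges uniformly on compact subsets of $\mathbb{D}$. *)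

(* Defs.v *)
From Stdlib Require Import Reals.
From Coquelicot Require Import Coquelicot.

Open Scope R_scope.

Definition null_set (E : R -> Prop) : Prop :=
  forall eps : R, 0 < eps ->
    exists a b : nat -> R,
      (forall n, a n <= b n) /\
      (forall x, E x -> exists n, a n < x < b n) /\
      (forall N, sum_f_R0 (fun n => b n - a n) N <= eps).

Definition in_disk (z : C) : Prop := Cmod z < 1.

Definition polar (r theta : R) : C := (r * cos theta, r * sin theta).

Definition holomorphic_on_disk (f : C -> C) : Prop :=
  forall z : C, in_disk z -> @ex_derive C_AbsRing C_NormedModule f z.

Definition inner (f : C -> C) : Prop :=
  holomorphic_on_disk f /\
  (exists M : R, forall z, in_disk z -> Cmod (f z) <= M) /\
  null_set (fun theta : R =>
     ~ (exists l : C, Cmod l = 1 /\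
          filterlim (fun r : R => f (polar r theta)) (at_left 1) (locally l))).

Definition T (z : C) : C := (Ci * ((1 - Ci * z) / (1 + Ci * z)))%C.

Definition series_unif_cv_on_closed_disk (u : nat -> C -> R) (r : R) : Prop :=
  exists S : C -> R, forall eps : R, 0 < eps ->
    exists N : nat, forall n : nat, (N <= n)%nat ->
      forall z : C, Cmod z <= r ->
        Rabs (S z - sum_f_R0 (fun k => u k z) n) < eps.

(* Locally uniform convergence on D: uniform convergence on every closed
   disk |z| <= r with 0 < r < 1 (equivalently, on every compact subset of D). *)
Definition series_loc_unif_cv (u : nat -> C -> R) : Prop :=
  forall r : R, 0 < r < 1 -> series_unif_cv_on_closed_disk u r.

Definition prod_abs_loc_unif_cv (w : nat -> C -> C) : Prop :=
  series_loc_unif_cv (fun n z => Cmod (1 - w n z)%C).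

(* Main.v *)
Require Import Defs.
From Stdlib Require Import Reals Lra Lia ClassicalEpsilon.
From Coquelicot Require Import Coquelicot.

(** Writing [a] and [b] for the values of [phip n] and [phim n],
    [1 - T a / T b = 2 i (a - b) / ((a - i) (b + i))].  On [|z| <= r] the denominator is bounded below
    by hypothesis and above by [4], because inner functions are bounded by [1]; so each series
    dominates the other from some index on.

    The bound [|f| <= 1] for inner [f] comes from the mean value property of
    [w (f w - f z) / (w - z)], which gives [|f z| <= K * mean |f (r e^(it))|] with [K] depending only on
    [z] once [r] is close to [1].  Applied to [f^k], with bounded convergence as [r -> 1], it shows that
    [|f z|^k] is bounded uniformly in [k]. *)

(** * Bisection and Goursat's theorem in Green's form *)

(** [inner] bounds [f] only by some [M], and controls the modulus only of almost every radial limit.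
    The factor [K] may exceed [1], so a single mean bound is too weak; but the same [K] serves every
    power [f^k], whose radial limits are again unimodular, and a bound on [|f z|^k] independent of
    [k] excludes [|f z| > 1]. Crude constants therefore suffice, and no exact Cauchy or Poisson
    formula is proved. Two obstacles shape the rest. Complex derivatives are not assumed continuous,
    so the equality of circle integrals comes from a bisection and not from differentiation under
    the integral sign. The exceptional angles are null in the sense of interval covers, while the
    integrals are Riemann integrals of continuous functions; the limit [r -> 1] is handled by
    compactness for decreasing sequences, followed by a passage to arbitrary bounded sequences. *)

Lemma nested_limit (a b : nat -> R) :
  (forall n, a n <= b n) ->
  (forall n, a n <= a (S n)) -> (forall n, b (S n) <= b n) ->
  exists x, forall n, a n <= x <= b n.
Proof.
intros Hab Ha Hb.
assert (Hal : forall n k, a n <= a (n + k)%nat).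
{ intros n k; induction k as [|k IH]; [rewrite Nat.add_0_r; lra|].
  rewrite Nat.add_succ_r; specialize (Ha (n + k)%nat); lra. }
assert (Hbl : forall n k, b (n + k)%nat <= b n).
{ intros n k; induction k as [|k IH]; [rewrite Nat.add_0_r; lra|].
  rewrite Nat.add_succ_r; specialize (Hb (n + k)%nat); lra. }
assert (Hmn : forall n m, a n <= b m).
{ intros n m. specialize (Hal n m); specialize (Hbl m n).
  rewrite (Nat.add_comm m n) in Hbl. specialize (Hab (n + m)%nat); lra. }
destruct (completeness (fun y => exists n, y = a n)) as [x [Hx1 Hx2]].
- exists (b 0%nat). intros y [n ->]. apply Hmn.
- now exists (a 0%nat), 0%nat.
- exists x. intros n; split.
  + apply Hx1. now exists n.
  + apply Hx2. intros y [m ->]. apply Hmn.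
Qed.

Lemma half_pow_small (w d : R) : 0 < d -> exists n : nat, w * (1 / 2) ^ n < d.
Proof.
intros Hd.
assert (L : is_lim_seq (fun n => w * (1 / 2) ^ n) (w * 0)).
{ apply (is_lim_seq_scal_l _ w 0). apply is_lim_seq_geom. rewrite Rabs_pos_eq; lra. }
apply is_lim_seq_spec in L. destruct (L (mkposreal d Hd)) as [N HN].
exists N. specialize (HN N (le_n _)). simpl in HN.
apply Rabs_def2 in HN. lra.
Qed.

(** If [P] fails on a rectangle, it fails on one of its quarters; the failing rectangles shrink to a
    point, where the local hypothesis contradicts them. The local hypothesis asks only that the
    small rectangle contain the point, which may lie on its boundary. *)
Lemma rect_induction (P : R -> R -> R -> R -> Prop) (A B C D : R) :
  A <= B -> C <= D ->
  (forall a b c d, A <= a <= b -> b <= B -> C <= c <= d -> d <= D ->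
     P a ((a + b) / 2) c ((c + d) / 2) -> P ((a + b) / 2) b c ((c + d) / 2) ->
     P a ((a + b) / 2) ((c + d) / 2) d -> P ((a + b) / 2) b ((c + d) / 2) d ->
     P a b c d) ->
  (forall x y, A <= x <= B -> C <= y <= D ->
     exists delta, 0 < delta /\
       forall a b c d, A <= a <= x -> x <= b <= B -> C <= c <= y -> y <= d <= D ->
         b - a < delta -> d - c < delta -> P a b c d) ->
  P A B C D.
Proof.
intros HAB HCD Hsplit Hloc.
apply NNPP; intros Hbad.
set (p4 := fun q : (R * R) * (R * R) =>
  P (fst (fst q)) (snd (fst q)) (fst (snd q)) (snd (snd q))).
set (lo := fun s : R * R => (fst s, (fst s + snd s) / 2)).
set (hi := fun s : R * R => ((fst s + snd s) / 2, snd s)).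
set (step := fun q : (R * R) * (R * R) =>
  if excluded_middle_informative (p4 (lo (fst q), lo (snd q))) then
  if excluded_middle_informative (p4 (hi (fst q), lo (snd q))) then
  if excluded_middle_informative (p4 (lo (fst q), hi (snd q)))
  (* The last quarter is taken without a test: by [Hsplit] it must fail when the other three satisfy
     [P]. *)
  then (hi (fst q), hi (snd q))
  else (lo (fst q), hi (snd q)) else (hi (fst q), lo (snd q)) else (lo (fst q), lo (snd q))).
set (q := fix q n := match n with O => ((A, B), (C, D)) | S n => step (q n) end).
assert (Hhalf : forall n,
  (fst (q (S n)) = lo (fst (q n)) \/ fst (q (S n)) = hi (fst (q n))) /\
  (snd (q (S n)) = lo (snd (q n)) \/ snd (q (S n)) = hi (snd (q n)))).
{ intros n; simpl; unfold step.
  destruct excluded_middle_informative; [|now auto].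
  destruct excluded_middle_informative; [|now auto].
  destruct excluded_middle_informative; now auto. }
assert (Hw : forall n,
  (A <= fst (fst (q n)) <= snd (fst (q n)) /\ snd (fst (q n)) <= B /\
   snd (fst (q n)) - fst (fst (q n)) = (B - A) * (1 / 2) ^ n) /\
  (C <= fst (snd (q n)) <= snd (snd (q n)) /\ snd (snd (q n)) <= D /\
   snd (snd (q n)) - fst (snd (q n)) = (D - C) * (1 / 2) ^ n)).
{ intros n; induction n as [|n [[I1 [I2 I3]] [J1 [J2 J3]]]].
  - simpl; lra.
  - destruct (Hhalf n) as [H1 H2].
    rewrite <- tech_pow_Rmult.
    split; [destruct H1 as [-> | ->] | destruct H2 as [-> | ->]]; simpl; lra. }
assert (Hn : forall n, ~ p4 (q n)).
{ intros n; induction n as [|n IH]; [exact Hbad|].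
  destruct (Hw n) as [[I1 [I2 I3]] [J1 [J2 J3]]].
  simpl; unfold step.
  destruct excluded_middle_informative as [h1|h1]; [|exact h1].
  destruct excluded_middle_informative as [h2|h2]; [|exact h2].
  destruct excluded_middle_informative as [h3|h3]; [|exact h3].
  intros h4; apply IH. now apply Hsplit. }
destruct (nested_limit (fun n => fst (fst (q n))) (fun n => snd (fst (q n)))) as [x Hx].
{ intros n; apply (Hw n). }
{ intros n. destruct (Hhalf n) as [[-> | ->] _]; destruct (Hw n); simpl; lra. }
{ intros n. destruct (Hhalf n) as [[-> | ->] _]; destruct (Hw n); simpl; lra. }
destruct (nested_limit (fun n => fst (snd (q n))) (fun n => snd (snd (q n)))) as [y Hy].
{ intros n; apply (Hw n). }
{ intros n. destruct (Hhalf n) as [_ [-> | ->]]; destruct (Hw n); simpl; lra. }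
{ intros n. destruct (Hhalf n) as [_ [-> | ->]]; destruct (Hw n); simpl; lra. }
destruct (Hloc x y) as [delta [Hd Hdelta]].
{ exact (Hx 0%nat). } { exact (Hy 0%nat). }
destruct (half_pow_small (Rmax (B - A) (D - C)) delta Hd) as [n Hsm].
assert (Hp : 0 < (1 / 2) ^ n) by (apply pow_lt; lra).
pose proof (Rmax_l (B - A) (D - C)) as M1. pose proof (Rmax_r (B - A) (D - C)) as M2.
apply (Rmult_le_compat_r _ _ _ (Rlt_le _ _ Hp)) in M1.
apply (Rmult_le_compat_r _ _ _ (Rlt_le _ _ Hp)) in M2.
specialize (Hx n); specialize (Hy n); destruct (Hw n) as [[I1 [I2 I3]] [J1 [J2 J3]]].
apply (Hn n), Hdelta; lra.
Qed.

Lemma interval_induction (P : R -> R -> Prop) (A B : R) :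
  A <= B ->
  (forall a b, A <= a <= b -> b <= B ->
     P a ((a + b) / 2) -> P ((a + b) / 2) b -> P a b) ->
  (forall x, A <= x <= B -> exists delta, 0 < delta /\
     forall a b, A <= a <= x -> x <= b <= B -> b - a < delta -> P a b) ->
  P A B.
Proof.
intros HAB Hsplit Hloc.
apply (rect_induction (fun a b _ _ => P a b) A B 0 0 HAB (Rle_refl 0)).
- auto.
- intros x y Hx Hy. destruct (Hloc x Hx) as [delta [Hd H]].
  exists delta; split; [exact Hd|]. intros; now apply H.
Qed.

Lemma RInt_near_const (g : R -> R) (k eta a b : R) :
  a <= b -> ex_RInt g a b -> (forall x, a <= x <= b -> Rabs (g x - k) <= eta) ->
  Rabs (RInt g a b - k * (b - a)) <= eta * (b - a).
Proof.
intros Hab Hg H.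
replace (RInt g a b - k * (b - a)) with (RInt (fun x => g x - k) a b).
- rewrite Rmult_comm. apply abs_RInt_le_const; auto.
  apply (ex_RInt_minus (V := R_NormedModule)); [exact Hg | apply ex_RInt_const].
- transitivity (minus (RInt g a b) (RInt (fun _ => k) a b)).
  + apply (RInt_minus (V := R_CompleteNormedModule)); [exact Hg | apply ex_RInt_const].
  + rewrite RInt_const. unfold minus, plus, opp, scal; simpl. unfold mult; simpl. ring.
Qed.

(** The form [P dx + Q dy] is closed at each point because [P_y] and [Q_x] share the value [k]. On a
    small rectangle the affine parts of [P] and [Q] integrate to zero, and the remainder is at most
    [eps] times the square of the half-perimeter. That square is divided by four in each quarter, so
    the bound adds up under bisection. *)
Lemma green_goursat (P Q : R -> R -> R) (A B C D : R) :
  A <= B -> C <= D ->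
  (forall x y, A <= x <= B -> C <= y <= D -> exists p k q,
     differentiable_pt_lim P x y p k /\ differentiable_pt_lim Q x y k q) ->
  RInt (fun x => P x C - P x D) A B + RInt (fun y => Q B y - Q A y) C D = 0.
Proof.
intros HAB HCD Hdiff.
(* [J] is the counterclockwise boundary integral: bottom minus top, then right minus left. *)
set (J := fun a b c d =>
  RInt (fun x => P x c - P x d) a b + RInt (fun y => Q b y - Q a y) c d).
assert (HcP : forall x y, A <= x <= B -> C <= y <= D -> continuity_2d_pt P x y).
{ intros x y Hx Hy. destruct (Hdiff x y Hx Hy) as [p [k [q [H _]]]].
  apply differentiable_continuity_pt. now exists p, k. }
assert (HcQ : forall x y, A <= x <= B -> C <= y <= D -> continuity_2d_pt Q x y).
{ intros x y Hx Hy. destruct (Hdiff x y Hx Hy) as [p [k [q [_ H]]]].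
  apply differentiable_continuity_pt. now exists k, q. }
assert (HP1 : forall y a b, A <= a <= b -> b <= B -> C <= y <= D ->
  ex_RInt (fun x => P x y) a b).
{ intros y a b Ha Hb Hy. apply (ex_RInt_continuous (V := R_CompleteNormedModule)).
  intros z Hz. rewrite Rmin_left, Rmax_right in Hz by lra.
  apply continuity_pt_filterlim. apply continuity_pt_locally. intros eps.
  destruct (HcP z y ltac:(lra) Hy eps) as [d Hd]. exists d. intros u Hu.
  apply Hd; [exact Hu|]. rewrite Rminus_eq_0, Rabs_R0. apply cond_pos. }
assert (HQ1 : forall x c d, C <= c <= d -> d <= D -> A <= x <= B ->
  ex_RInt (fun y => Q x y) c d).
{ intros x c d Hc Hd Hx. apply (ex_RInt_continuous (V := R_CompleteNormedModule)).
  intros z Hz. rewrite Rmin_left, Rmax_right in Hz by lra.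
  apply continuity_pt_filterlim. apply continuity_pt_locally. intros eps.
  destruct (HcQ x z Hx ltac:(lra) eps) as [e He]. exists e. intros u Hu.
  apply He; [|exact Hu]. rewrite Rminus_eq_0, Rabs_R0. apply cond_pos. }
assert (HP2 : forall a b c d, A <= a <= b -> b <= B -> C <= c <= D -> C <= d <= D ->
  ex_RInt (fun x => P x c - P x d) a b).
{ intros. apply (ex_RInt_minus (V := R_NormedModule)); apply HP1; lra. }
assert (HQ2 : forall a b c d, C <= c <= d -> d <= D -> A <= a <= B -> A <= b <= B ->
  ex_RInt (fun y => Q b y - Q a y) c d).
{ intros. apply (ex_RInt_minus (V := R_NormedModule)); apply HQ1; lra. }
assert (HPm : forall a b c d, A <= a <= b -> b <= B -> C <= c <= D -> C <= d <= D ->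
  RInt (fun x => P x c - P x d) a b = RInt (fun x => P x c) a b - RInt (fun x => P x d) a b).
{ intros. apply (RInt_minus (V := R_CompleteNormedModule)); apply HP1; lra. }
assert (HQm : forall a b c d, C <= c <= d -> d <= D -> A <= a <= B -> A <= b <= B ->
  RInt (fun y => Q b y - Q a y) c d = RInt (fun y => Q b y) c d - RInt (fun y => Q a y) c d).
{ intros. apply (RInt_minus (V := R_CompleteNormedModule)); apply HQ1; lra. }
assert (key : forall eps, 0 < eps ->
  Rabs (J A B C D) <= eps * ((B - A) + (D - C)) ^ 2).
{ intros eps Heps.
  apply (rect_induction (fun a b c d =>
    Rabs (J a b c d) <= eps * ((b - a) + (d - c)) ^ 2)); [exact HAB | exact HCD | |].
  - intros a b c d Ha Hb Hc Hd H1 H2 H3 H4.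
    set (m := (a + b) / 2) in *. set (n := (c + d) / 2) in *.
    assert (Hm : a <= m <= b) by (unfold m; lra).
    assert (Hn : c <= n <= d) by (unfold n; lra).
    assert (E : J a b c d = J a m c n + J m b c n + J a m n d + J m b n d).
    { unfold J.
      rewrite (HPm a b c d), (HPm a m c n), (HPm m b c n), (HPm a m n d), (HPm m b n d) by lra.
      rewrite (HQm a b c d), (HQm a m c n), (HQm m b c n), (HQm a m n d), (HQm m b n d) by lra.
      rewrite <- (RInt_Chasles (V := R_CompleteNormedModule) (fun x => P x c) a m b)
        by (apply HP1; lra).
      rewrite <- (RInt_Chasles (V := R_CompleteNormedModule) (fun x => P x d) a m b)
        by (apply HP1; lra).
      rewrite <- (RInt_Chasles (V := R_CompleteNormedModule) (fun y => Q a y) c n d)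
        by (apply HQ1; lra).
      rewrite <- (RInt_Chasles (V := R_CompleteNormedModule) (fun y => Q b y) c n d)
        by (apply HQ1; lra).
      unfold plus; simpl; ring. }
    rewrite E.
    apply Rle_trans with (1 := Rabs_triang _ _).
    apply Rle_trans with (1 := Rplus_le_compat_r _ _ _ (Rabs_triang _ _)).
    apply Rle_trans with (1 := Rplus_le_compat_r _ _ _ (Rplus_le_compat_r _ _ _ (Rabs_triang _ _))).
    replace (m - a) with ((b - a) / 2) in * by (unfold m; field).
    replace (b - m) with ((b - a) / 2) in * by (unfold m; field).
    replace (n - c) with ((d - c) / 2) in * by (unfold n; field).
    replace (d - n) with ((d - c) / 2) in * by (unfold n; field).
    replace (((b - a) / 2 + (d - c) / 2) ^ 2) with ((b - a + (d - c)) ^ 2 / 4) in * by field.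
    lra.
  - intros x y Hx Hy. destruct (Hdiff x y Hx Hy) as [p [k [q [HdP HdQ]]]].
    assert (He2 : 0 < eps / 2) by lra.
    destruct (HdP (mkposreal _ He2)) as [d1 Hd1].
    destruct (HdQ (mkposreal _ He2)) as [d2 Hd2].
    exists (Rmin d1 d2). split; [apply Rmin_pos; apply cond_pos|].
    intros a b c d Ha Hb Hc Hd Hab Hcd.
    pose proof (Rmin_l d1 d2) as M1. pose proof (Rmin_r d1 d2) as M2.
    assert (EP : forall u v, a <= u <= b -> c <= v <= d ->
      Rabs (P u v - P x y - (p * (u - x) + k * (v - y))) <= eps / 2 * ((b - a) + (d - c))).
    { intros u v Hu Hv.
      assert (Rabs (u - x) <= b - a) by (apply Rabs_le; lra).
      assert (Rabs (v - y) <= d - c) by (apply Rabs_le; lra).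
      apply Rle_trans with (eps / 2 * Rmax (Rabs (u - x)) (Rabs (v - y))).
      - apply Hd1; lra.
      - apply Rmult_le_compat_l; [lra|]. apply Rmax_lub; lra. }
    assert (EQ : forall u v, a <= u <= b -> c <= v <= d ->
      Rabs (Q u v - Q x y - (k * (u - x) + q * (v - y))) <= eps / 2 * ((b - a) + (d - c))).
    { intros u v Hu Hv.
      assert (Rabs (u - x) <= b - a) by (apply Rabs_le; lra).
      assert (Rabs (v - y) <= d - c) by (apply Rabs_le; lra).
      apply Rle_trans with (eps / 2 * Rmax (Rabs (u - x)) (Rabs (v - y))).
      - apply Hd2; lra.
      - apply Rmult_le_compat_l; [lra|]. apply Rmax_lub; lra. }
    (* In the difference of opposite sides the terms in [p] and [q] cancel. What remains is
       [k * (c - d)] integrated over [[a, b]] and [k * (b - a)] integrated over [[c, d]], and these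
       two cancel each other. *)
    assert (I1 := RInt_near_const (fun u => P u c - P u d) (k * (c - d))
      (eps * ((b - a) + (d - c))) a b ltac:(lra) (HP2 a b c d ltac:(lra) ltac:(lra) ltac:(lra) ltac:(lra))).
    assert (I2 := RInt_near_const (fun v => Q b v - Q a v) (k * (b - a))
      (eps * ((b - a) + (d - c))) c d ltac:(lra) (HQ2 a b c d ltac:(lra) ltac:(lra) ltac:(lra) ltac:(lra))).
    assert (I1' : Rabs (RInt (fun u => P u c - P u d) a b - k * (c - d) * (b - a)) <=
      eps * (b - a + (d - c)) * (b - a)).
    { apply I1. intros u Hu. generalize (EP u c Hu ltac:(lra)) (EP u d Hu ltac:(lra)).
      intros e1 e2. apply Rabs_le_between in e1, e2. apply Rabs_le_between. lra. }
    assert (I2' : Rabs (RInt (fun v => Q b v - Q a v) c d - k * (b - a) * (d - c)) <=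
      eps * (b - a + (d - c)) * (d - c)).
    { apply I2. intros v Hv. generalize (EQ a v ltac:(lra) Hv) (EQ b v ltac:(lra) Hv).
      intros e1 e2. apply Rabs_le_between in e1, e2. apply Rabs_le_between. lra. }
    unfold J. apply Rabs_le_between in I1', I2'. apply Rabs_le_between. lra. }
change (J A B C D = 0).
apply NNPP; intros Hne.
assert (H0 : 0 < Rabs (J A B C D)) by now apply Rabs_pos_lt.
set (K := ((B - A) + (D - C)) ^ 2) in *.
assert (HK : 0 <= K) by apply pow2_ge_0.
assert (HK1 : 0 < K + 1) by lra.
specialize (key (Rabs (J A B C D) / (2 * (K + 1)))).
assert (Hpos : 0 < Rabs (J A B C D) / (2 * (K + 1))) by (apply Rdiv_lt_0_compat; lra).
specialize (key Hpos).
assert (Rabs (J A B C D) / (2 * (K + 1)) * (K + 1) = Rabs (J A B C D) / 2) by (field; lra).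
nra.
Qed.

(** * Bounded convergence off a null set *)

Lemma ex_RInt_cont (g : R -> R) (a b : R) :
  (forall x, continuous g x) -> ex_RInt g a b.
Proof.
intros H. apply (ex_RInt_continuous (V := R_CompleteNormedModule)). intros z _; apply H.
Qed.

Lemma RInt_bound (g : R -> R) (K a b : R) :
  a <= b -> (forall x, continuous g x) -> (forall x, a <= x <= b -> g x <= K) ->
  RInt g a b <= K * (b - a).
Proof.
intros Hab Hc HK.
apply Rle_trans with (RInt (fun _ => K) a b).
- apply RInt_le; [exact Hab | now apply ex_RInt_cont | apply ex_RInt_const | intros; apply HK; lra].
- rewrite RInt_const. unfold scal; simpl; unfold mult; simpl. lra.
Qed.

Lemma sum_f_R0_ge_term (u : nat -> R) (n : nat) :
  (forall k, 0 <= u k) -> u n <= sum_f_R0 u n.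
Proof.
intros H. destruct n as [|n]; simpl; [lra|]. pose proof (cond_pos_sum u n H). lra.
Qed.

Lemma sum_f_R0_incr (u : nat -> R) (n m : nat) :
  (forall k, 0 <= u k) -> (n <= m)%nat -> sum_f_R0 u n <= sum_f_R0 u m.
Proof.
intros H Hnm. induction Hnm as [|m Hnm IH]; [lra|]. simpl. specialize (H (S m)). lra.
Qed.

(** Dini's theorem by bisection. Near a point of [E] a single covering interval contains the whole
    small segment, and the integral costs at most [M] times its length; near any other point some
    [g m] is below [eta] by continuity. Monotonicity lets the larger index serve both halves when
    segments are joined. *)
Lemma dini_off_null_set (g : nat -> R -> R) (E : R -> Prop) (M a b : R) :
  a <= b -> null_set E ->
  (forall n x, continuous (g n) x) ->
  (forall n x, 0 <= g n x <= M) ->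
  (forall n x, g (S n) x <= g n x) ->
  (forall x, ~ E x -> is_lim_seq (fun n => g n x) 0) ->
  forall c, 0 < c -> exists m, RInt (g m) a b <= c.
Proof.
intros Hab HE Hcont Hbd Hdec Hlim c Hc.
assert (HM : 0 <= M) by (specialize (Hbd 0%nat 0); lra).
(* The cover contributes at most [c / 2] after multiplication by [M], and [eta] accounts for the
   other half; each [+ 1] keeps a denominator positive. *)
destruct (HE (c / (2 * (M + 1)))) as [al [be [H1 [H2 H3]]]].
{ apply Rdiv_lt_0_compat; lra. }
set (eta := c / (2 * (b - a + 1))).
assert (Heta : 0 < eta) by (apply Rdiv_lt_0_compat; lra).
(* [L x y n] is the length of the part of [[x, y]] inside the [n]-th covering interval. Adjacent
   segments share no length, so the sums over the cover add up under bisection and never exceed its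
   total length. *)
set (L := fun x y n => Rmax 0 (Rmin (be n) y - Rmax (al n) x)).
assert (HL0 : forall x y n, 0 <= L x y n) by (intros; apply Rmax_l).
assert (Hmono : forall m m' x, (m <= m')%nat -> g m' x <= g m x).
{ intros m m' x Hm. induction Hm as [|m' Hm IH]; [lra|]. specialize (Hdec m' x); lra. }
assert (HI : forall m m' x y, x <= y -> (m <= m')%nat -> RInt (g m') x y <= RInt (g m) x y).
{ intros m m' x y Hxy Hm. apply RInt_le; auto using ex_RInt_cont. }
destruct (interval_induction (fun x y => exists m N,
  RInt (g m) x y <= eta * (y - x) + M * sum_f_R0 (L x y) N) a b Hab) as [m [N HmN]].
- intros x y Hx Hy [m1 [N1 A1]] [m2 [N2 A2]].
  set (z := (x + y) / 2) in *.
  assert (Hz : x <= z <= y) by (unfold z; lra).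
  exists (max m1 m2), (max N1 N2).
  rewrite <- (RInt_Chasles (V := R_CompleteNormedModule) _ x z y)
    by (apply ex_RInt_cont; apply Hcont).
  unfold plus; simpl.
  pose proof (HI m1 (max m1 m2) x z ltac:(lra) (Nat.le_max_l _ _)).
  pose proof (HI m2 (max m1 m2) z y ltac:(lra) (Nat.le_max_r _ _)).
  pose proof (sum_f_R0_incr (L x z) N1 (max N1 N2) (HL0 x z) (Nat.le_max_l _ _)) as S1.
  pose proof (sum_f_R0_incr (L z y) N2 (max N1 N2) (HL0 z y) (Nat.le_max_r _ _)) as S2.
  assert (S3 : sum_f_R0 (L x z) (max N1 N2) + sum_f_R0 (L z y) (max N1 N2)
    <= sum_f_R0 (L x y) (max N1 N2)).
  { rewrite <- sum_plus. apply sum_Rle. intros n _. unfold L.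
    unfold Rmin, Rmax; repeat destruct Rle_dec; lra. }
  apply (Rmult_le_compat_l M) in S1; [|exact HM].
  apply (Rmult_le_compat_l M) in S2; [|exact HM].
  apply (Rmult_le_compat_l M) in S3; [|exact HM].
  lra.
- intros x Hx. destruct (excluded_middle_informative (E x)) as [HEx|HEx].
  + destruct (H2 x HEx) as [n Hn].
    exists (Rmin (be n - x) (x - al n)). split; [apply Rmin_pos; lra|].
    intros u v Hu Hv Huv. exists 0%nat, n.
    assert (HLn : L u v n = v - u).
    { pose proof (Rmin_l (be n - x) (x - al n)). pose proof (Rmin_r (be n - x) (x - al n)).
      unfold L. rewrite (Rmin_right (be n) v), (Rmax_right (al n) u), Rmax_right; lra. }
    pose proof (sum_f_R0_ge_term (L u v) n (HL0 u v)) as S1. rewrite HLn in S1.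
    apply (Rmult_le_compat_l M) in S1; [|exact HM].
    pose proof (RInt_bound (g 0%nat) M u v ltac:(lra) (Hcont 0%nat) (fun x _ => proj2 (Hbd 0%nat x))).
    assert (0 <= eta * (v - u)) by (apply Rmult_le_pos; lra).
    lra.
  + specialize (Hlim x HEx). apply is_lim_seq_spec in Hlim.
    assert (He2 : 0 < eta / 2) by lra.
    destruct (Hlim (mkposreal _ He2)) as [m Hm].
    specialize (Hm m (le_n _)). simpl in Hm. apply Rabs_def2 in Hm.
    pose proof (Hcont m x) as Hcx. apply continuity_pt_filterlim in Hcx.
    rewrite continuity_pt_locally in Hcx.
    destruct (Hcx (mkposreal _ He2)) as [d Hd].
    exists d. split; [apply cond_pos|].
    intros u v Hu Hv Huv. exists m, 0%nat.
    pose proof (RInt_bound (g m) eta u v ltac:(lra) (Hcont m)) as HR.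
    assert (HR' : RInt (g m) u v <= eta * (v - u)).
    { apply HR. intros y Hy.
      assert (Hb : Rabs (y - x) < d) by (apply Rabs_def1; lra).
      specialize (Hd y Hb). simpl in Hd. apply Rabs_def2 in Hd. lra. }
    assert (0 <= M * sum_f_R0 (L u v) 0) by (apply Rmult_le_pos; [exact HM | apply HL0]).
    lra.
- exists m. apply Rle_trans with (1 := HmN).
  assert (S1 : sum_f_R0 (L a b) N <= c / (2 * (M + 1))).
  { apply Rle_trans with (2 := H3 N). apply sum_Rle. intros n _. unfold L.
    specialize (H1 n). unfold Rmin, Rmax; repeat destruct Rle_dec; lra. }
  apply (Rmult_le_compat_l M) in S1; [|exact HM].
  assert (E1 : c / (2 * (M + 1)) * (M + 1) = c / 2) by (field; lra).
  assert (E2 : eta * (b - a + 1) = c / 2) by (unfold eta; field; lra).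
  assert (0 < c / (2 * (M + 1))) by (apply Rdiv_lt_0_compat; lra).
  nra.
Qed.

(** * Lattice operations on continuous functions, and Daniell's passage to bounded sequences *)

Lemma continuous_Rmax (f g : R -> R) (x : R) :
  continuous f x -> continuous g x -> continuous (fun y => Rmax (f y) (g y)) x.
Proof.
intros Hf Hg.
apply (continuous_ext (fun y => ((f y + g y) + Rabs (f y - g y)) * / 2)).
{ intros y. unfold Rabs, Rmax. destruct Rcase_abs, Rle_dec; simpl; lra. }
apply (continuous_mult (K := R_AbsRing)); [|apply continuous_const].
apply (continuous_plus (V := R_NormedModule)).
- now apply (continuous_plus (V := R_NormedModule)).
- apply continuous_comp; [now apply (continuous_minus (V := R_NormedModule)) | apply continuous_Rabs].
Qed.

Lemma continuous_Rmin (f g : R -> R) (x : R) :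
  continuous f x -> continuous g x -> continuous (fun y => Rmin (f y) (g y)) x.
Proof.
intros Hf Hg.
apply (continuous_ext (fun y => f y + g y - Rmax (f y) (g y))).
{ intros y. unfold Rmin, Rmax. destruct Rle_dec; simpl; lra. }
apply (continuous_minus (V := R_NormedModule)).
- now apply (continuous_plus (V := R_NormedModule)).
- now apply continuous_Rmax.
Qed.

(** The window [m .. m + n] is finite so that the maximum stays continuous, hence Riemann
    integrable; the supremum over all [j >= m] might not be. *)
Fixpoint running_max (h : nat -> R -> R) (m n : nat) (x : R) : R :=
  match n with
  | O => h m x
  | S n => Rmax (running_max h m n x) (h (m + S n)%nat x)
  end.

Lemma running_max_le (h : nat -> R -> R) (m n : nat) (x K : R) :
  (forall j, (m <= j)%nat -> h j x <= K) -> running_max h m n x <= K.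
Proof.
intros H; induction n as [|n IH]; simpl.
- apply H; lia.
- apply Rmax_lub; [exact IH | apply H; lia].
Qed.

Lemma running_max_ge (h : nat -> R -> R) (m n j : nat) (x : R) :
  (m <= j <= m + n)%nat -> h j x <= running_max h m n x.
Proof.
induction n as [|n IH]; intros Hj; simpl.
- replace j with m by lia. lra.
- destruct (Nat.eq_dec j (m + S n)) as [-> | Hne].
  + apply Rmax_r.
  + apply Rle_trans with (2 := Rmax_l _ _). apply IH. lia.
Qed.

Lemma running_max_incl (h : nat -> R -> R) (m n m' n' : nat) (x : R) :
  (m' <= m)%nat -> (m + n <= m' + n')%nat ->
  running_max h m n x <= running_max h m' n' x.
Proof.
intros Hm Hn; induction n as [|n IH]; simpl.
- apply running_max_ge. lia.
- apply Rmax_lub; [apply IH; lia | apply running_max_ge; lia].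
Qed.

Lemma continuous_running_max (h : nat -> R -> R) (m n : nat) (x : R) :
  (forall j, continuous (h j) x) -> continuous (running_max h m n) x.
Proof.
intros H; induction n as [|n IH]; simpl; [apply H|].
now apply continuous_Rmax.
Qed.

Lemma bounded_increasing_almost_max (u : nat -> R) (K e : R) :
  0 < e -> (forall n, u n <= K) -> exists n, forall k, u k <= u n + e.
Proof.
intros He HK.
destruct (completeness (fun y => exists n, y = u n)) as [s [Hs1 Hs2]].
- exists K. now intros y [n ->].
- now exists (u 0%nat), 0%nat.
- apply NNPP; intros Hno.
  assert (Hle : s <= s - e).
  { apply Hs2. intros y [n ->].
    apply NNPP; intros Hn. apply Hno. exists n. intros k.
    assert (u k <= s) by (apply Hs1; now exists k). lra. }
  lra.
Qed.

(* Daniell's argument: each [G m] is a decreasing minimum of nearly maximal running maxima, so that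
   passing from [G m] to [G (S m)] costs at most [e m], by [min + max = sum]. *)
Lemma bounded_convergence_off_null_set (h : nat -> R -> R) (E : R -> Prop) (M a b : R) :
  a <= b -> null_set E ->
  (forall n x, continuous (h n) x) ->
  (forall n x, 0 <= h n x <= M) ->
  (forall x, ~ E x -> is_lim_seq (fun n => h n x) 0) ->
  forall c, 0 < c -> exists m, RInt (h m) a b <= c.
Proof.
intros Hab HE Hcont Hbd Hlim c Hc.
apply NNPP; intros Hno.
assert (Hbig : forall m, c <= RInt (h m) a b).
{ intros m. apply Rnot_lt_le; intros Hm. apply Hno. exists m; lra. }
set (e := fun m : nat => c / 4 * (1 / 2) ^ m).
assert (He : forall m, 0 < e m).
{ intros m. apply Rmult_lt_0_compat; [lra | apply pow_lt; lra]. }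
set (H := running_max h).
assert (HcH : forall m n x, continuous (H m n) x).
{ intros. apply continuous_running_max. intros; apply Hcont. }
assert (HH : forall m n x, 0 <= H m n x <= M).
{ intros m n x. split.
  - apply Rle_trans with (h m x); [apply Hbd | apply running_max_ge; lia].
  - apply running_max_le. intros; apply Hbd. }
assert (Hsel : forall m, exists n, forall k, RInt (H m k) a b <= RInt (H m n) a b + e m).
{ intros m. apply (bounded_increasing_almost_max _ (M * (b - a))); [apply He|].
  intros k. apply RInt_bound; [exact Hab | apply HcH | intros; apply HH]. }
set (N := fun m => proj1_sig (constructive_indefinite_description _ (Hsel m))).
assert (HN : forall m k, RInt (H m k) a b <= RInt (H m (N m)) a b + e m).
{ intros m. exact (proj2_sig (constructive_indefinite_description _ (Hsel m))). }
set (G := fix G m x := match m with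
  | O => H 0%nat (N 0%nat) x
  | S m => Rmin (G m x) (H (S m) (N (S m)) x) end).
assert (HcG : forall m x, continuous (G m) x).
{ intros m x; induction m as [|m IH]; simpl; [apply HcH|]. now apply continuous_Rmin. }
assert (HG0 : forall m x, 0 <= G m x).
{ intros m x; induction m as [|m IH]; simpl; [apply HH|].
  apply Rmin_glb; [exact IH | apply HH]. }
assert (HGH : forall m x, G m x <= H m (N m) x).
{ intros [|m] x; simpl; [lra | apply Rmin_r]. }
(* The allowance [c / 2 - 2 * e m] is the sum of the costs [e 0], ..., [e (m - 1)]. It stays below
   [c / 2], so the integral of [G m] stays above [c / 2], which contradicts the limit [0] of the
   decreasing sequence [G]. *)
assert (Hint : forall m, RInt (H m (N m)) a b - (c / 2 - 2 * e m) <= RInt (G m) a b).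
{ intros m; induction m as [|m IH].
  - change (RInt (G 0%nat) a b) with (RInt (H 0%nat (N 0%nat)) a b).
    assert (e 0%nat = c / 4) by (unfold e; simpl; field). lra.
  - set (B := H (S m) (N (S m))).
    (* [G m] and [B] both lie below one running maximum that starts at [m], and by the choice of
       [N m] its integral exceeds that of [H m (N m)] by at most [e m]. *)
    assert (Emax : RInt (fun x => Rmax (G m x) (B x)) a b <= RInt (H m (N m)) a b + e m).
    { apply Rle_trans with (2 := HN m (N m + S (N (S m)))%nat).
      apply RInt_le; [exact Hab | | |].
      - apply ex_RInt_cont. intros x. apply continuous_Rmax; [apply HcG | apply HcH].
      - apply ex_RInt_cont, HcH.
      - intros x _. apply Rmax_lub.
        + apply Rle_trans with (1 := HGH m x). apply running_max_incl; lia.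
        + apply running_max_incl; lia. }
    assert (Esum : RInt (G (S m)) a b + RInt (fun x => Rmax (G m x) (B x)) a b
      = RInt (G m) a b + RInt B a b).
    { transitivity (RInt (fun x => plus (G (S m) x) (Rmax (G m x) (B x))) a b).
      - symmetry. apply (RInt_plus (V := R_CompleteNormedModule)).
        + apply ex_RInt_cont, HcG.
        + apply ex_RInt_cont. intros x. apply continuous_Rmax; [apply HcG | apply HcH].
      - rewrite <- (RInt_plus (V := R_CompleteNormedModule))
          by (apply ex_RInt_cont; solve [apply HcG | apply HcH]).
        apply RInt_ext. intros x _. simpl. unfold plus; simpl. fold B.
        unfold Rmin, Rmax; destruct Rle_dec; lra. }
    assert (Ee : e (S m) = e m / 2) by (unfold e; simpl; field).
    fold B. lra. }
destruct (dini_off_null_set G E M a b Hab HE HcG) with (c := c / 4) as [m Hm].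
- intros n x. split; [apply HG0|]. apply Rle_trans with (1 := HGH n x). apply HH.
- intros n x. simpl. apply Rmin_l.
- intros x Hx. specialize (Hlim x Hx). apply is_lim_seq_spec in Hlim.
  apply is_lim_seq_spec. intros eps.
  assert (He2 : 0 < eps / 2) by (pose proof (cond_pos eps); lra).
  destruct (Hlim (mkposreal _ He2)) as [n0 Hn0].
  exists n0. intros n Hn. rewrite Rminus_0_r, Rabs_pos_eq by apply HG0.
  apply Rle_lt_trans with (1 := HGH n x).
  apply Rle_lt_trans with (eps / 2); [|lra].
  apply running_max_le. intros j Hj.
  specialize (Hn0 j ltac:(lia)). simpl in Hn0. apply Rabs_def2 in Hn0. lra.
- lra.
- specialize (Hint m). specialize (He m).
  assert (HB : RInt (h m) a b <= RInt (H m (N m)) a b).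
  { apply RInt_le; [exact Hab | apply ex_RInt_cont, Hcont | apply ex_RInt_cont, HcH|].
    intros x _. apply running_max_ge. lia. }
  specialize (Hbig m). lra.
Qed.

(** * Complex differentiation and circle integrals *)

Definition has_cderiv (f : C -> C) (z d : C) : Prop :=
  forall eps, 0 < eps -> exists delta, 0 < delta /\
    forall w, Cmod (w - z)%C < delta ->
      Cmod (f w - f z - (w - z) * d)%C <= eps * Cmod (w - z)%C.

Lemma is_derive_has_cderiv (f : C -> C) (z d : C) :
  @is_derive C_AbsRing C_NormedModule f z d -> has_cderiv f z d.
Proof.
intros [_ H] eps Heps.
destruct (H z (fun P HP => HP) (mkposreal eps Heps)) as [delta Hdelta].
exists delta. split; [apply cond_pos|].
intros w Hw. exact (Hdelta w Hw).
Qed.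

Lemma has_cderiv_lipschitz (f : C -> C) (z d : C) :
  has_cderiv f z d -> exists delta, 0 < delta /\
    forall w, Cmod (w - z)%C < delta ->
      Cmod (f w - f z)%C <= (1 + Cmod d) * Cmod (w - z)%C.
Proof.
intros H. destruct (H 1 Rlt_0_1) as [delta [Hd Hdelta]].
exists delta. split; [exact Hd|]. intros w Hw. specialize (Hdelta w Hw).
replace (f w - f z)%C with ((f w - f z - (w - z) * d) + (w - z) * d)%C by ring.
apply Rle_trans with (1 := Cmod_triangle _ _). rewrite (Cmod_mult (w - z)). lra.
Qed.

Lemma has_cderiv_const (c z : C) : has_cderiv (fun _ => c) z 0.
Proof.
intros eps Heps. exists 1. split; [lra|]. intros w _.
replace (c - c - (w - z) * 0)%C with (RtoC 0) by ring. rewrite Cmod_0.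
apply Rmult_le_pos; [lra | apply Cmod_ge_0].
Qed.

Lemma has_cderiv_id (z : C) : has_cderiv (fun w => w) z 1.
Proof.
intros eps Heps. exists 1. split; [lra|]. intros w _.
replace (w - z - (w - z) * 1)%C with (RtoC 0) by ring. rewrite Cmod_0.
apply Rmult_le_pos; [lra | apply Cmod_ge_0].
Qed.

Lemma has_cderiv_mult (f g : C -> C) (z df dg : C) :
  has_cderiv f z df -> has_cderiv g z dg ->
  has_cderiv (fun w => f w * g w)%C z (df * g z + f z * dg)%C.
Proof.
intros Hf Hg eps Heps.
destruct (has_cderiv_lipschitz f z df Hf) as [d1 [Hd1 H1]].
destruct (has_cderiv_lipschitz g z dg Hg) as [d2 [Hd2 H2]].
set (Lf := 1 + Cmod df) in *. set (Lg := 1 + Cmod dg) in *.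
assert (HLf : 0 < Lf) by (unfold Lf; generalize (Cmod_ge_0 df); lra).
assert (HLg : 0 < Lg) by (unfold Lg; generalize (Cmod_ge_0 dg); lra).
assert (HLL : 0 < Lf * Lg) by now apply Rmult_lt_0_compat.
pose proof (Cmod_ge_0 (f z)) as Pf. pose proof (Cmod_ge_0 (g z)) as Pg.
assert (E1 : 0 < eps / (3 * (Cmod (g z) + 1))) by (apply Rdiv_lt_0_compat; lra).
assert (E2 : 0 < eps / (3 * (Cmod (f z) + 1))) by (apply Rdiv_lt_0_compat; lra).
destruct (Hf _ E1) as [d3 [Hd3 H3]]. destruct (Hg _ E2) as [d4 [Hd4 H4]].
set (d5 := eps / (3 * (Lf * Lg))).
assert (Hd5 : 0 < d5) by (apply Rdiv_lt_0_compat; lra).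
exists (Rmin (Rmin d1 d2) (Rmin (Rmin d3 d4) d5)).
split; [repeat apply Rmin_pos; assumption|].
intros w Hw.
assert (W : Cmod (w - z)%C < d1 /\ Cmod (w - z)%C < d2 /\ Cmod (w - z)%C < d3 /\
  Cmod (w - z)%C < d4 /\ Cmod (w - z)%C < d5).
{ revert Hw. unfold Rmin. repeat destruct Rle_dec; lra. }
destruct W as [W1 [W2 [W3 [W4 W5]]]].
specialize (H1 w W1). specialize (H2 w W2). specialize (H3 w W3). specialize (H4 w W4).
replace (f w * g w - f z * g z - (w - z) * (df * g z + f z * dg))%C with
  ((f w - f z - (w - z) * df) * g z + f z * (g w - g z - (w - z) * dg)
   + (f w - f z) * (g w - g z))%C by ring.
apply Rle_trans with (1 := Cmod_triangle _ _).
apply Rle_trans with (1 := Rplus_le_compat_r _ _ _ (Cmod_triangle _ _)).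
rewrite !Cmod_mult.
set (D := Cmod (w - z)%C) in *.
assert (HD : 0 <= D) by apply Cmod_ge_0.
assert (A1 : Cmod (f w - f z - (w - z) * df)%C * Cmod (g z) <= eps / 3 * D).
{ apply Rle_trans with (eps / (3 * (Cmod (g z) + 1)) * D * (Cmod (g z) + 1)).
  - apply Rmult_le_compat; try apply Cmod_ge_0; lra.
  - apply Req_le. field. lra. }
assert (A2 : Cmod (f z) * Cmod (g w - g z - (w - z) * dg)%C <= eps / 3 * D).
{ apply Rle_trans with ((Cmod (f z) + 1) * (eps / (3 * (Cmod (f z) + 1)) * D)).
  - apply Rmult_le_compat; try apply Cmod_ge_0; lra.
  - apply Req_le. field. lra. }
assert (A3 : Cmod (f w - f z)%C * Cmod (g w - g z)%C <= eps / 3 * D).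
{ apply Rle_trans with ((Lf * D) * (Lg * D)).
  - apply Rmult_le_compat; try apply Cmod_ge_0; assumption.
  - replace (Lf * D * (Lg * D)) with (Lf * Lg * D * D) by ring.
    apply Rmult_le_compat_r; [exact HD|].
    apply Rle_trans with (Lf * Lg * d5).
    + apply Rmult_le_compat_l; lra.
    + apply Req_le. unfold d5. field. lra. }
lra.
Qed.

Lemma has_cderiv_plus_const (f : C -> C) (z d c : C) :
  has_cderiv f z d -> has_cderiv (fun w => f w + c)%C z d.
Proof.
intros H eps Heps. destruct (H eps Heps) as [delta [Hd Hdelta]].
exists delta. split; [exact Hd|]. intros w Hw.
replace (f w + c - (f z + c) - (w - z) * d)%C with (f w - f z - (w - z) * d)%C by ring.
now apply Hdelta.
Qed.

Lemma Csub_neq_0 (a b : C) : a <> b -> (a - b)%C <> 0.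
Proof.
intros Hab E. apply Hab. replace a with ((a - b) + b)%C by ring. rewrite E. ring.
Qed.

Lemma has_cderiv_inv_sub (a z : C) :
  z <> a -> has_cderiv (fun w => / (w - a))%C z (- / ((z - a) * (z - a)))%C.
Proof.
intros Hza eps Heps.
pose proof (Csub_neq_0 _ _ Hza) as Hn.
assert (Hm : 0 < Cmod (z - a)%C) by now apply Cmod_gt_0.
set (m := Cmod (z - a)%C) in *.
assert (Hm3 : 0 < m * m * m) by (repeat apply Rmult_lt_0_compat; lra).
(* The first bound keeps [|w - a| >= m / 2], so the remainder [|w - z|^2 / (|w - a| * m^2)] is at
   most [2 * |w - z|^2 / m^3]; the second bound makes this at most [eps * |w - z|]. *)
exists (Rmin (m / 2) (eps * (m * m * m) / 2)). split.
{ apply Rmin_pos; [lra|]. assert (0 < eps * (m * m * m)) by now apply Rmult_lt_0_compat. lra. }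
intros w Hw.
pose proof (Rmin_l (m / 2) (eps * (m * m * m) / 2)).
pose proof (Rmin_r (m / 2) (eps * (m * m * m) / 2)).
assert (Hwa : m / 2 <= Cmod (w - a)%C).
{ assert (T1 : m <= Cmod (w - a)%C + Cmod (w - z)%C).
  { unfold m. replace (z - a)%C with ((w - a) + - (w - z))%C by ring.
    apply Rle_trans with (1 := Cmod_triangle _ _). rewrite Cmod_opp. lra. }
  lra. }
assert (Hwn : (w - a)%C <> 0) by (apply Cmod_gt_0; lra).
replace (/ (w - a) - / (z - a) - (w - z) * - / ((z - a) * (z - a)))%C
  with ((w - z) * (w - z) * / ((w - a) * ((z - a) * (z - a))))%C
  by (field; split; assumption).
rewrite !Cmod_mult, Cmod_inv by (repeat apply Cmult_neq_0; assumption).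
rewrite !Cmod_mult. fold m.
rewrite (Rmult_comm eps), Rmult_assoc.
apply Rmult_le_compat_l; [apply Cmod_ge_0|].
apply Rle_trans with (eps * (m * m * m) / 2 * / (m / 2 * (m * m))).
- apply Rmult_le_compat; [apply Cmod_ge_0 | | lra |].
  + apply Rlt_le, Rinv_0_lt_compat. repeat apply Rmult_lt_0_compat; lra.
  + apply Rinv_le_contravar.
    * repeat apply Rmult_lt_0_compat; lra.
    * apply Rmult_le_compat_r; [|exact Hwa]. apply Rlt_le, Rmult_lt_0_compat; lra.
- apply Req_le. field. lra.
Qed.

Lemma has_cderiv_pow (f : C -> C) (z d : C) (k : nat) :
  has_cderiv f z d -> exists d', has_cderiv (fun w => f w ^ k)%C z d'.
Proof.
intros H. induction k as [|k [d' IH]]; simpl.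
- exists 0. apply has_cderiv_const.
- eexists. exact (has_cderiv_mult _ _ _ _ _ H IH).
Qed.

Lemma continuous_of_cmod (f : C -> C) (z : C) :
  (forall eps, 0 < eps -> exists delta, 0 < delta /\
     forall w, Cmod (w - z)%C < delta -> Cmod (f w - f z)%C < eps) ->
  continuous f z.
Proof.
intros H. apply filterlim_locally. intros eps.
destruct (H eps (cond_pos eps)) as [delta [Hd Hdelta]].
(* Balls of the product structure on [C] are squares; passing to [Cmod] costs a factor
   [sqrt 2 <= 2], hence half the radius. *)
assert (Hd2 : 0 < delta / 2) by lra.
exists (mkposreal _ Hd2). intros w Hw.
apply C_NormedModule_mixin_compat1. apply (Hdelta w).
apply Rlt_le_trans with (1 := C_NormedModule_mixin_compat2 z w _ Hw). simpl.
assert (sqrt 2 <= 2).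
{ rewrite <- (sqrt_square 2) at 2 by lra. apply sqrt_le_1_alt. lra. }
nra.
Qed.

Lemma has_cderiv_continuous (f : C -> C) (z d : C) : has_cderiv f z d -> continuous f z.
Proof.
intros H. destruct (has_cderiv_lipschitz f z d H) as [d1 [Hd1 H1]].
apply continuous_of_cmod. intros eps Heps.
assert (HL : 0 < 1 + Cmod d) by (generalize (Cmod_ge_0 d); lra).
exists (Rmin d1 (eps / (1 + Cmod d))). split.
{ apply Rmin_pos; [exact Hd1 | now apply Rdiv_lt_0_compat]. }
intros w Hw.
pose proof (Rmin_l d1 (eps / (1 + Cmod d))). pose proof (Rmin_r d1 (eps / (1 + Cmod d))).
apply Rle_lt_trans with (1 := H1 w ltac:(lra)).
apply Rlt_le_trans with ((1 + Cmod d) * (eps / (1 + Cmod d))).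
- apply Rmult_lt_compat_l; lra.
- apply Req_le. field. lra.
Qed.

Lemma continuous_Re (f : C -> C) (z : C) : continuous f z -> continuous (fun w => Re (f w)) z.
Proof.
intros H. apply (continuous_comp f fst); [exact H | apply continuous_fst].
Qed.

Lemma continuous_Im (f : C -> C) (z : C) : continuous f z -> continuous (fun w => Im (f w)) z.
Proof.
intros H. apply (continuous_comp f snd); [exact H | apply continuous_snd].
Qed.

(** The Cauchy-Riemann equations: the real differential of [f] is multiplication by [d]. No
    continuity of the partial derivatives is involved. *)
Lemma has_cderiv_differentiable_Re_Im (f : C -> C) (x y : R) (d : C) :
  has_cderiv f (x, y) d ->
  differentiable_pt_lim (fun u v => Re (f (u, v))) x y (Re d) (- Im d) /\
  differentiable_pt_lim (fun u v => Im (f (u, v))) x y (Im d) (Re d).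
Proof.
intros H.
assert (K : forall eps : posreal, locally_2d (fun u v =>
  Cmod (f (u, v) - f (x, y) - ((u, v) - (x, y)) * d)%C
    <= eps * Rmax (Rabs (u - x)) (Rabs (v - y))) x y).
{ intros eps.
  assert (He : 0 < eps / 2) by (generalize (cond_pos eps); lra).
  destruct (H _ He) as [delta [Hd Hdelta]].
  assert (Hd2 : 0 < delta / 2) by lra.
  exists (mkposreal _ Hd2). intros u v Hu Hv. simpl in Hu, Hv.
  assert (Hs : sqrt 2 <= 2).
  { rewrite <- (sqrt_square 2) at 2 by lra. apply sqrt_le_1_alt. lra. }
  assert (HC : Cmod ((u, v) - (x, y))%C <= 2 * Rmax (Rabs (u - x)) (Rabs (v - y))).
  { apply Rle_trans with (1 := Cmod_2Rmax _). simpl.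
    apply Rmult_le_compat_r; [|exact Hs].
    apply Rle_trans with (1 := Rabs_pos (u - x)). apply Rmax_l. }
  assert (HR : Rmax (Rabs (u - x)) (Rabs (v - y)) < delta / 2) by now apply Rmax_lub_lt.
  apply Rle_trans with (1 := Hdelta (u, v) ltac:(lra)).
  apply Rle_trans with (eps / 2 * (2 * Rmax (Rabs (u - x)) (Rabs (v - y)))).
  - apply Rmult_le_compat_l; lra.
  - lra. }
split; intros eps; destruct (K eps) as [delta Hdelta]; exists delta; intros u v Hu Hv;
  apply Rle_trans with (2 := Hdelta u v Hu Hv);
  eapply Rle_trans with (2 := Rmax_Cmod _).
- eapply Rle_trans with (2 := Rmax_l _ _). apply Req_le. f_equal. simpl. unfold Re, Im. ring.
- eapply Rle_trans with (2 := Rmax_r _ _). apply Req_le. f_equal. simpl. unfold Re, Im. ring.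
Qed.

(** * Polar coordinates and integrals over circles *)

Lemma differentiable_pt_lim_Rmult (x y : R) :
  differentiable_pt_lim (fun u v => u * v) x y y x.
Proof.
intros eps. exists eps. intros u v Hu Hv.
replace (u * v - x * y - (y * (u - x) + x * (v - y))) with ((u - x) * (v - y)) by ring.
rewrite Rabs_mult. apply Rmult_le_compat; try apply Rabs_pos; [lra | apply Rmax_r].
Qed.

Lemma differentiable_pt_lim_snd (g : R -> R) (x y l : R) :
  derivable_pt_lim g y l -> differentiable_pt_lim (fun _ v => g v) x y 0 l.
Proof.
intros H.
assert (Hs : differentiable_pt_lim (fun _ v => v) x y 0 1).
{ intros eps. exists eps. intros u v _ _.
  replace (v - y - (0 * (u - x) + 1 * (v - y))) with 0 by ring. rewrite Rabs_R0.
  apply Rmult_le_pos; [apply Rlt_le, cond_pos|].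
  apply Rle_trans with (1 := Rabs_pos (u - x)). apply Rmax_l. }
pose proof (differentiable_pt_lim_comp (fun u _ => g u) (fun _ v => v) (fun _ v => v) x y
  l 0 0 1 0 1 (differentiable_pt_lim_proj1_0 g y y l H) Hs Hs) as D.
simpl in D. replace (l * 0 + 0 * 0) with 0 in D by ring.
now replace (l * 1 + 0 * 1) with l in D by ring.
Qed.

Lemma differentiable_pt_lim_prod (f g : R -> R -> R) (x y fx fy gx gy : R) :
  differentiable_pt_lim f x y fx fy -> differentiable_pt_lim g x y gx gy ->
  differentiable_pt_lim (fun u v => f u v * g u v) x y
    (g x y * fx + f x y * gx) (g x y * fy + f x y * gy).
Proof.
intros Hf Hg.
exact (differentiable_pt_lim_comp Rmult f g x y _ _ _ _ _ _
  (differentiable_pt_lim_Rmult _ _) Hf Hg).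
Qed.

Lemma differentiable_pt_lim_polar (r t : R) :
  differentiable_pt_lim (fun u v => u * cos v) r t (cos t) (- r * sin t) /\
  differentiable_pt_lim (fun u v => u * sin v) r t (sin t) (r * cos t).
Proof.
assert (H1 : differentiable_pt_lim (fun u _ => u) r t 1 0).
{ apply (differentiable_pt_lim_proj1_0 (fun u => u)). apply derivable_pt_lim_id. }
split.
- pose proof (differentiable_pt_lim_prod _ _ _ _ _ _ _ _ H1
    (differentiable_pt_lim_snd cos r t _ (derivable_pt_lim_cos t))) as D.
  replace (cos t) with (cos t * 1 + r * 0) at 1 by ring.
  now replace (- r * sin t) with (cos t * 0 + r * - sin t) by ring.
- pose proof (differentiable_pt_lim_prod _ _ _ _ _ _ _ _ H1
    (differentiable_pt_lim_snd sin r t _ (derivable_pt_lim_sin t))) as D.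
  replace (sin t) with (sin t * 1 + r * 0) at 1 by ring.
  now replace (r * cos t) with (sin t * 0 + r * cos t) by ring.
Qed.

Lemma Cmod_polar (r t : R) : 0 <= r -> Cmod (polar r t) = r.
Proof.
intros Hr. unfold Cmod, polar; simpl.
replace (_ + _) with (r * r * ((sin t)² + (cos t)²)) by (unfold Rsqr; ring).
rewrite sin2_cos2, Rmult_1_r. now apply sqrt_square.
Qed.

Lemma continuous_polar (r t : R) :
  continuous (fun p : R * R => polar (fst p) (snd p)) (r, t).
Proof.
destruct (differentiable_pt_lim_polar r t) as [D1 D2].
assert (C1 : continuity_2d_pt (fun u v => u * cos v) r t)
  by (apply differentiable_continuity_pt; eexists; eexists; exact D1).
assert (C2 : continuity_2d_pt (fun u v => u * sin v) r t)
  by (apply differentiable_continuity_pt; eexists; eexists; exact D2).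
apply filterlim_locally. intros eps.
destruct (C1 eps) as [d1 H1]. destruct (C2 eps) as [d2 H2].
assert (Hd : 0 < Rmin d1 d2) by (apply Rmin_pos; apply cond_pos).
exists (mkposreal _ Hd). intros [u v] [Hu Hv].
pose proof (Rmin_l d1 d2). pose proof (Rmin_r d1 d2).
assert (Rabs (u - r) < Rmin d1 d2) by exact Hu.
assert (Rabs (v - t) < Rmin d1 d2) by exact Hv.
split; [exact (H1 u v ltac:(lra) ltac:(lra)) | exact (H2 u v ltac:(lra) ltac:(lra))].
Qed.

Lemma continuous_polar_r (N : C -> R) (r t : R) :
  continuous N (polar r t) -> continuous (fun t => N (polar r t)) t.
Proof.
intros H.
apply (continuous_comp (fun t => (r, t)) (fun p => N (polar (fst p) (snd p)))).
- apply filterlim_locally. intros eps. exists eps. intros v Hv. split; [apply ball_center | exact Hv].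
- apply (continuous_comp (fun p : R * R => polar (fst p) (snd p)) N);
    [apply continuous_polar | exact H].
Qed.

Lemma circle_integral_const (f : C -> C) (r1 r2 : R) :
  0 < r1 <= r2 ->
  (forall z, r1 <= Cmod z <= r2 -> exists d, has_cderiv f z d) ->
  RInt (fun t => Re (f (polar r1 t))) 0 (2 * PI) =
  RInt (fun t => Re (f (polar r2 t))) 0 (2 * PI).
Proof.
intros Hr Hf.
pose proof PI_RGT_0 as Hpi.
(* With [z = r e^(it)], the form [Re f dt + (Im f / r) dr] is closed. *)
pose proof (green_goursat (fun r t => Im (f (polar r t)) * / r)
  (fun r t => Re (f (polar r t))) r1 r2 0 (2 * PI) ltac:(lra) ltac:(lra)) as Gr.
assert (Hc : forall r, r1 <= r <= r2 -> forall t, continuous (fun t => Re (f (polar r t))) t).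
{ intros r Hrr t. apply (continuous_polar_r (fun z => Re (f z))). apply continuous_Re.
  destruct (Hf (polar r t)) as [d Hd]; [rewrite Cmod_polar; lra|].
  now apply has_cderiv_continuous with d. }
(* The annulus is the rectangle [[r1, r2] x [0, 2 pi]] in polar coordinates; its sides [t = 0] and
   [t = 2 pi] cancel by periodicity. *)
rewrite (RInt_ext _ (fun _ => 0)) in Gr.
2:{ intros r _. unfold polar. rewrite cos_2PI, sin_2PI, cos_0, sin_0. apply Rminus_diag. }
rewrite RInt_const in Gr.
unfold scal in Gr; simpl in Gr; unfold mult in Gr; simpl in Gr.
rewrite Rmult_0_r in Gr.
assert (Em : RInt (fun t => Re (f (polar r2 t)) - Re (f (polar r1 t))) 0 (2 * PI) =
  RInt (fun t => Re (f (polar r2 t))) 0 (2 * PI) - RInt (fun t => Re (f (polar r1 t))) 0 (2 * PI)).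
{ apply (RInt_minus (V := R_CompleteNormedModule)); apply ex_RInt_cont; apply Hc; lra. }
rewrite Em in Gr.
enough (0 + (RInt (fun t => Re (f (polar r2 t))) 0 (2 * PI) -
  RInt (fun t => Re (f (polar r1 t))) 0 (2 * PI)) = 0) by lra.
apply Gr. intros r t Hrr _.
destruct (Hf (polar r t)) as [d Hd]; [rewrite Cmod_polar; lra|].
destruct (differentiable_pt_lim_polar r t) as [D1 D2].
destruct (has_cderiv_differentiable_Re_Im f _ _ d Hd) as [DR DI].
pose proof (differentiable_pt_lim_comp _ _ _ _ _ _ _ _ _ _ _ DR D1 D2) as ER.
pose proof (differentiable_pt_lim_comp _ _ _ _ _ _ _ _ _ _ _ DI D1 D2) as EI.
assert (Di : differentiable_pt_lim (fun u _ => / u) r t (- 1 / (r * r)) 0).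
{ apply (differentiable_pt_lim_proj1_0 (fun u => / u)).
  apply is_derive_Reals. auto_derive; [lra|]. field. lra. }
pose proof (differentiable_pt_lim_prod _ _ _ _ _ _ _ _ EI Di) as EP.
(* The common mixed derivative is the radial derivative of [Re f]; by Cauchy-Riemann it equals the
   angular derivative of [Im f] divided by [r]. *)
eexists; exists (Re d * cos t - Im d * sin t); eexists; split.
- refine (eq_ind _ (fun k => differentiable_pt_lim _ _ _ _ k) EP _ _). field. lra.
- refine (eq_ind _ (fun k => differentiable_pt_lim _ _ _ k _) ER _ _). ring.
Qed.

Lemma continuous_circle_integral (N : C -> R) (r : R) :
  (forall t, continuous N (polar r t)) ->
  forall eps, 0 < eps -> exists delta, 0 < delta /\
    forall s, Rabs (s - r) < delta -> (forall t, continuous N (polar s t)) ->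
      Rabs (RInt (fun t => N (polar s t)) 0 (2 * PI) - RInt (fun t => N (polar r t)) 0 (2 * PI)) < eps.
Proof.
intros Hr eps Heps. pose proof PI_RGT_0 as Hpi.
set (e := eps / (4 * PI)).
assert (He : 0 < e) by (apply Rdiv_lt_0_compat; lra).
destruct (uniform_continuity_2d_1d' (fun s t => N (polar s t)) 0 (2 * PI) r) with
  (eps := mkposreal e He) as [delta Hdelta].
{ intros t _. apply continuity_2d_pt_filterlim.
  apply (continuous_comp (fun p : R * R => polar (fst p) (snd p)) N (r, t));
    [apply continuous_polar | apply Hr]. }
simpl in Hdelta.
exists delta. split; [apply cond_pos|]. intros s Hs Hc.
assert (E : RInt (fun t => N (polar s t) - N (polar r t)) 0 (2 * PI) =
  RInt (fun t => N (polar s t)) 0 (2 * PI) - RInt (fun t => N (polar r t)) 0 (2 * PI)).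
{ apply (RInt_minus (V := R_CompleteNormedModule)); apply ex_RInt_cont; intros t;
    apply continuous_polar_r; auto. }
rewrite <- E. apply Rabs_def2 in Hs. pose proof (cond_pos delta).
apply Rle_lt_trans with ((2 * PI - 0) * e).
- apply abs_RInt_le_const; [lra | |].
  + apply ex_RInt_cont. intros t. apply (continuous_minus (V := R_NormedModule));
      apply continuous_polar_r; auto.
  + intros t Ht. apply Rlt_le, Hdelta; try lra.
    rewrite Rminus_eq_0, Rabs_R0. lra.
- replace ((2 * PI - 0) * e) with (eps / 2) by (unfold e; field; lra). lra.
Qed.

(** * The mean value bound *)

Lemma exists_phase (a : C) : exists c, Cmod c <= 1 /\ (c * a)%C = RtoC (Cmod a).
Proof.
destruct (excluded_middle_informative (a = 0)) as [-> | Ha].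
- exists 0. rewrite Cmod_0. split; [lra|]. ring.
- assert (Hm : 0 < Cmod a) by now apply Cmod_gt_0.
  assert (Hn : RtoC (Cmod a) <> 0).
  { intros E. apply RtoC_inj in E. lra. }
  exists (Cconj a / Cmod a)%C. split.
  + rewrite Cmod_div by exact Hn. rewrite Cmod_conj, Cmod_R, Rabs_pos_eq by lra.
    apply Req_le. field. lra.
  + transitivity ((a * Cconj a) / Cmod a)%C; [field; exact Hn|].
    rewrite <- Cmod2_conj, RtoC_pow. field. exact Hn.
Qed.

(** With [u = z / w] this is [1 / (1 - u)], which maps the unit disk into the half-plane
    [Re > 1 / 2]. In coordinates, twice the numerator minus [D] equals [|w|^2 - |z|^2]. *)
Lemma Re_div_sub_ge_half (z w : C) :
  Cmod z < Cmod w -> 1 / 2 <= Re (w * / (w - z))%C.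
Proof.
intros H. destruct z as [x y], w as [a b].
assert (H2 : x ^ 2 + y ^ 2 < a ^ 2 + b ^ 2).
{ unfold Cmod in H; simpl fst in H; simpl snd in H. now apply sqrt_lt_0_alt. }
set (D := (a - x) ^ 2 + (b - y) ^ 2).
assert (HD : 0 < D).
{ unfold D. assert (0 <= (a - x) ^ 2) by apply pow2_ge_0. assert (0 <= (b - y) ^ 2) by apply pow2_ge_0.
  destruct (Req_dec a x) as [-> | Hax].
  - destruct (Req_dec b y) as [-> | Hby]; [lra|]. assert (0 < (b - y) ^ 2) by (apply pow2_gt_0; lra). lra.
  - assert (0 < (a - x) ^ 2) by (apply pow2_gt_0; lra). lra. }
replace (Re ((a, b) * / ((a, b) - (x, y)))%C) with ((a * (a - x) + b * (b - y)) / D).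
- apply Rmult_le_reg_r with D; [exact HD|]. unfold Rdiv. rewrite (Rmult_assoc _ (/ D)), Rinv_l by lra.
  unfold D. lra.
- unfold Re, Cmult, Cinv, Cminus, Cplus, Copp; simpl.
  replace ((a + - x) * ((a + - x) * 1) + (b + - y) * ((b + - y) * 1)) with D by (unfold D; ring).
  field. lra.
Qed.

(** The factor [w] makes [G] vanish at [0], so the mean of [Re G] over every circle is [0]. On
    [|w| = r] this balances the part containing [f w], at most [K * |f w|], against
    [|f z| * Re (w / (w - z))], at least [|f z| / 2]. Integrating that [1 / 2] over a full turn
    gives the factor [PI]. *)
Lemma mean_value_bound (f : C -> C) (z : C) (r : R) :
  (forall w, in_disk w -> exists d, has_cderiv f w d) ->
  Cmod z < r < 1 ->
  Cmod (f z) * PI <=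
    r / (r - Cmod z) * RInt (fun t => Cmod (f (polar r t))) 0 (2 * PI).
Proof.
intros Hf [Hzr Hr1]. pose proof PI_RGT_0 as Hpi. pose proof (Cmod_ge_0 z) as Hz0.
destruct (Hf z) as [d Hd]; [unfold in_disk; lra|].
destruct (exists_phase (f z)) as [c [Hc1 Hc2]].
(* The value [d] at [z] makes the difference quotient continuous there, which is all that the
   argument uses at [z]. *)
set (q := fun w => if excluded_middle_informative (w = z) then d else ((f w - f z) * / (w - z))%C).
set (G := fun w => (c * w * q w)%C).
assert (Gd : forall w, in_disk w -> w <> z -> exists d', has_cderiv G w d').
{ intros w Hw Hwz. destruct (Hf w Hw) as [d1 Hd1].
  pose proof (has_cderiv_mult _ _ _ _ _
    (has_cderiv_mult _ _ _ _ _ (has_cderiv_const c w) (has_cderiv_id w))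
    (has_cderiv_mult _ _ _ _ _ (has_cderiv_plus_const f w d1 (- f z)%C Hd1)
      (has_cderiv_inv_sub z w Hwz))) as HG.
  eexists. intros eps Heps. destruct (HG eps Heps) as [d2 [Hd2 H2]].
  assert (Hm : 0 < Cmod (w - z)%C) by (now apply Cmod_gt_0, Csub_neq_0).
  exists (Rmin d2 (Cmod (w - z)%C)). split; [now apply Rmin_pos|].
  intros v Hv. pose proof (Rmin_l d2 (Cmod (w - z)%C)). pose proof (Rmin_r d2 (Cmod (w - z)%C)).
  assert (Hvz : v <> z).
  { intros ->. replace (z - w)%C with (- (w - z))%C in Hv by ring. rewrite Cmod_opp in Hv. lra. }
  unfold G, q. destruct excluded_middle_informative; [contradiction|].
  destruct excluded_middle_informative; [contradiction|].
  apply H2. lra. }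
assert (qc : continuous q z).
{ apply continuous_of_cmod. intros eps Heps.
  assert (He2 : 0 < eps / 2) by lra.
  destruct (Hd _ He2) as [delta [Hdl H]]. exists delta. split; [exact Hdl|].
  intros w Hw. unfold q. destruct (excluded_middle_informative (z = z)); [|contradiction].
  destruct excluded_middle_informative as [-> | Hwz].
  - replace (d - d)%C with (RtoC 0) by ring. rewrite Cmod_0. exact Heps.
  - assert (Hn : (w - z)%C <> 0) by now apply Csub_neq_0.
    assert (Hm : 0 < Cmod (w - z)%C) by now apply Cmod_gt_0.
    replace ((f w - f z) * / (w - z) - d)%C with ((f w - f z - (w - z) * d) / (w - z))%C
      by (field; exact Hn).
    rewrite Cmod_div by exact Hn.
    apply Rle_lt_trans with (eps / 2 * Cmod (w - z)%C / Cmod (w - z)%C).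
    + apply Rmult_le_compat_r; [apply Rlt_le, Rinv_0_lt_compat, Hm | now apply H].
    + field_simplify; lra. }
assert (Gc : forall w, in_disk w -> continuous (fun v => Re (G v)) w).
{ intros w Hw. destruct (excluded_middle_informative (w = z)) as [-> | Hwz].
  - apply (continuous_ext (fun v => Re (c * v)%C * Re (q v) - Im (c * v)%C * Im (q v))).
    { intros v. reflexivity. }
    assert (Cl : continuous (fun v : C => (c * v)%C) z).
    { eapply has_cderiv_continuous.
      exact (has_cderiv_mult _ _ _ _ _ (has_cderiv_const c z) (has_cderiv_id z)). }
    apply (continuous_minus (V := R_NormedModule)); apply (continuous_mult (K := R_AbsRing)).
    + now apply continuous_Re.
    + now apply continuous_Re.
    + now apply continuous_Im.
    + now apply continuous_Im.
  - destruct (Gd w Hw Hwz) as [d' Hd']. apply continuous_Re. now apply has_cderiv_continuous with d'. }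
assert (Gp : forall s, 0 <= s < 1 -> forall t, continuous (fun v => Re (G v)) (polar s t)).
{ intros s Hs t. apply Gc. unfold in_disk. rewrite Cmod_polar; lra. }
set (A := fun s => RInt (fun t => Re (G (polar s t))) 0 (2 * PI)).
assert (Acont : forall s, 0 <= s < 1 -> forall eps, 0 < eps -> exists delta, 0 < delta /\
  forall s', 0 <= s' < 1 -> Rabs (s' - s) < delta -> Rabs (A s' - A s) < eps).
{ intros s Hs eps Heps.
  destruct (continuous_circle_integral (fun w => Re (G w)) s (Gp s Hs) eps Heps)
    as [delta [Hdl H]].
  exists delta. split; [exact Hdl|]. intros s' Hs' Hss. apply H; auto. }
assert (Aconst : forall s1 s2, 0 < s1 <= s2 -> s2 < 1 -> (s2 < Cmod z \/ Cmod z < s1) -> A s1 = A s2).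
{ intros s1 s2 Hs1 Hs2 Hne. apply circle_integral_const; [exact Hs1|].
  intros w Hw. apply Gd; [unfold in_disk; lra|]. intros ->. lra. }
(* [G] is only known to be continuous at [z], so Goursat says nothing about the circle [|w| = |z|];
   continuity of [A] carries the value [A 0 = 0] across it. *)
assert (Aright : forall s s', 0 <= s < s' -> s' < 1 -> (s' < Cmod z \/ Cmod z <= s) -> A s' = A s).
{ intros s s' Hs Hs' Hne. apply NNPP; intros Hneq.
  assert (He : 0 < Rabs (A s' - A s)) by (apply Rabs_pos_lt; lra).
  destruct (Acont s ltac:(lra) _ He) as [delta [Hdl H]].
  set (u := Rmin (s + delta / 2) s').
  assert (Hu : s < u <= s' /\ u < s + delta) by (unfold u, Rmin; destruct Rle_dec; lra).
  specialize (H u ltac:(lra) ltac:(apply Rabs_def1; lra)).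
  rewrite (Aconst u s') in H; lra. }
assert (A0 : A 0 = 0).
{ unfold A. rewrite (RInt_ext _ (fun _ => 0)).
  - rewrite RInt_const. unfold scal; simpl; unfold mult; simpl. apply Rmult_0_r.
  - intros t _. unfold G, polar. rewrite !Rmult_0_l.
    change (0, 0) with (RtoC 0). rewrite Cmult_0_r, Cmult_0_l. reflexivity. }
assert (Az : A (Cmod z) = 0).
{ destruct (Rle_lt_or_eq_dec _ _ Hz0) as [Hz | Hz]; [|now rewrite <- Hz].
  apply NNPP; intros Hneq.
  assert (He : 0 < Rabs (A (Cmod z))) by (now apply Rabs_pos_lt).
  destruct (Acont (Cmod z) ltac:(lra) _ He) as [delta [Hdl H]].
  set (u := Rmax (Cmod z - delta / 2) (Cmod z / 2)).
  assert (Hu : 0 < u < Cmod z /\ Cmod z - delta < u) by (unfold u, Rmax; destruct Rle_dec; lra).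
  specialize (H u ltac:(lra) ltac:(apply Rabs_def1; lra)).
  rewrite (Aright 0 u), A0 in H by lra. rewrite Rminus_0_l, Rabs_Ropp in H. lra. }
assert (Ar : A r = 0) by (rewrite (Aright (Cmod z) r); lra).
assert (Hcf : forall t, continuous (fun t => Cmod (f (polar r t))) t).
{ intros t. apply (continuous_polar_r (fun w => Cmod (f w))).
  destruct (Hf (polar r t)) as [d' Hd']; [unfold in_disk; rewrite Cmod_polar; lra|].
  apply (continuous_comp f Cmod); [now apply has_cderiv_continuous with d'|].
  apply (filterlim_norm (V := C_NormedModule)). }
set (K := r / (r - Cmod z)).
assert (HI : A r <= RInt (fun t => K * Cmod (f (polar r t)) - Cmod (f z) / 2) 0 (2 * PI)).
{ unfold A. apply RInt_le.
  - lra.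
  - apply ex_RInt_cont. intros t. apply (continuous_polar_r (fun w => Re (G w))). apply Gp. lra.
  - apply ex_RInt_cont. intros t. apply (continuous_minus (V := R_NormedModule)).
    + apply (continuous_scal_r (V := R_NormedModule) K). apply Hcf.
    + apply continuous_const.
  - intros t _. set (w := polar r t).
    assert (Hw : Cmod w = r) by (apply Cmod_polar; lra).
    assert (Hwz : w <> z) by (intros E; rewrite E in Hw; lra).
    assert (Hn : (w - z)%C <> 0) by now apply Csub_neq_0.
    assert (Hge : r - Cmod z <= Cmod (w - z)%C).
    { rewrite <- Hw. replace w with ((w - z) + z)%C at 1 by ring.
      pose proof (Cmod_triangle (w - z) z). lra. }
    assert (EG : G w = (c * w * f w / (w - z) - Cmod (f z) * (w * / (w - z)))%C).
    { unfold G, q. destruct excluded_middle_informative; [contradiction|].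
      rewrite <- Hc2. field. exact Hn. }
    rewrite EG.
    replace (Re (c * w * f w / (w - z) - Cmod (f z) * (w * / (w - z)))%C) with
      (Re (c * w * f w / (w - z))%C - Cmod (f z) * Re (w * / (w - z))%C)
      by (unfold Re, Im; simpl; ring).
    assert (H1 : Re (c * w * f w / (w - z))%C <= K * Cmod (f w)).
    { apply Rle_trans with (1 := Rle_abs _). apply Rle_trans with (1 := re_le_Cmod _).
      rewrite Cmod_div by exact Hn. rewrite !Cmod_mult, Hw. unfold K, Rdiv.
      replace (r * / (r - Cmod z) * Cmod (f w)) with (1 * r * Cmod (f w) * / (r - Cmod z)) by ring.
      apply Rmult_le_compat.
      - repeat apply Rmult_le_pos; try apply Cmod_ge_0; lra.
      - apply Rlt_le, Rinv_0_lt_compat. lra.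
      - apply Rmult_le_compat_r; [apply Cmod_ge_0|]. apply Rmult_le_compat_r; lra.
      - apply Rinv_le_contravar; lra. }
    pose proof (Re_div_sub_ge_half z w ltac:(lra)) as H2.
    apply (Rmult_le_compat_l _ _ _ (Cmod_ge_0 (f z))) in H2. lra. }
assert (E : RInt (fun t => K * Cmod (f (polar r t)) - Cmod (f z) / 2) 0 (2 * PI) =
  K * RInt (fun t => Cmod (f (polar r t))) 0 (2 * PI) - Cmod (f z) * PI).
{ transitivity (minus (RInt (fun t => scal K (Cmod (f (polar r t)))) 0 (2 * PI))
    (RInt (fun _ => Cmod (f z) / 2) 0 (2 * PI))).
  - apply (RInt_minus (V := R_CompleteNormedModule)).
    + apply ex_RInt_cont. intros t. apply (continuous_scal_r (V := R_NormedModule) K). apply Hcf.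
    + apply ex_RInt_const.
  - rewrite RInt_const, (RInt_scal (V := R_CompleteNormedModule)) by now apply ex_RInt_cont.
    unfold minus, plus, opp, scal; simpl; unfold mult; simpl. field. }
lra.
Qed.

(** * Boundedness of inner functions *)

Lemma radial_limit_Cmod (f : C -> C) (t : R) (r : nat -> R) (l : C) :
  filterlim (fun s => f (polar s t)) (at_left 1) (locally l) ->
  (forall n, r n < 1) -> is_lim_seq r 1 ->
  is_lim_seq (fun n => Cmod (f (polar (r n) t))) (Cmod l).
Proof.
intros Hl Hr1 Hr.
apply (filterlim_comp _ _ _ (fun n => f (polar (r n) t)) Cmod eventually (locally l)).
- apply (filterlim_comp _ _ _ r (fun s => f (polar s t)) eventually (at_left 1)); [|exact Hl].
  intros P HP. unfold at_left, within in HP.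
  specialize (Hr _ HP). destruct Hr as [N HN]. exists N. intros n Hn. apply HN; auto.
- apply (filterlim_norm (V := C_NormedModule)).
Qed.

Lemma bounded_powers_le_1 (x K : R) : (forall k : nat, x ^ k <= K) -> 0 <= x -> x <= 1.
Proof.
intros HK Hx. apply Rnot_lt_le; intros H1.
destruct (Pow_x_infinity x) with (b := K + 1) as [N HN].
{ rewrite Rabs_pos_eq; lra. }
specialize (HN N (le_n _)). rewrite Rabs_pos_eq in HN by now apply pow_le.
specialize (HK N). lra.
Qed.

Lemma inner_Cmod_le_1 (f : C -> C) (z : C) : inner f -> in_disk z -> Cmod (f z) <= 1.
Proof.
intros [Hhol [[M HM] Hnull]] Hz. unfold in_disk in Hz.
pose proof PI_RGT_0 as Hpi. pose proof (Cmod_ge_0 z) as Hz0.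
assert (Hf : forall w, in_disk w -> exists d, has_cderiv f w d).
{ intros w Hw. destruct (Hhol w Hw) as [d Hd]. exists d. now apply is_derive_has_cderiv. }
(* [1 - e] is the midpoint of [|z|] and [1]; all radii [r n] lie beyond it, so [r n - |z| >= e] and
   [K <= / e] for every [n]. *)
set (e := (1 - Cmod z) / 2). assert (He : 0 < e) by (unfold e; lra).
set (r := fun n : nat => 1 - e * / (INR n + 1)).
assert (Hinv : forall n, 0 < / (INR n + 1) <= 1).
{ intros n. pose proof (pos_INR n). split; [apply Rinv_0_lt_compat; lra|].
  rewrite <- Rinv_1. apply Rinv_le_contravar; lra. }
assert (Hr : forall n, 1 - e <= r n < 1) by (intros n; unfold r; specialize (Hinv n); nra).
assert (Hrlim : is_lim_seq r 1).
{ unfold r. replace (Finite 1) with (Finite (1 - e * 0)) by (f_equal; ring).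
  apply is_lim_seq_minus'; [apply is_lim_seq_const|].
  apply (is_lim_seq_scal_l _ e 0).
  apply is_lim_seq_ext with (fun n => / INR (S n)).
  - intros n. now rewrite S_INR.
  - apply (is_lim_seq_incr_1 (fun n => / INR n)).
    apply (is_lim_seq_inv INR p_infty); [apply is_lim_seq_INR | discriminate]. }
assert (Hdisk : forall n t, in_disk (polar (r n) t)).
{ intros n t. unfold in_disk. specialize (Hr n). rewrite Cmod_polar; unfold e in *; lra. }
assert (HM0 : 0 <= M).
{ apply Rle_trans with (1 := Cmod_ge_0 (f z)). now apply HM. }
(* The bound is [/ e] for [K], times [2 * PI + 1] for the integral of [|f|^k], divided by the [PI]
   of the mean value bound. The radius chosen below depends on [k], the bound does not. *)
apply bounded_powers_le_1 with ((2 * PI + 1) / e / PI); [|apply Cmod_ge_0].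
intros k.
(* Only the excess of [|f|^k] over [1] matters. Its positive part lies between [0] and [M ^ k] and
   tends to [0] wherever the radial limit is unimodular. *)
set (h := fun n t => Rmax 0 (Cmod (f (polar (r n) t)) ^ k - 1)).
assert (Hpc : forall n t, continuous (fun t => Cmod (f (polar (r n) t)) ^ k) t).
{ intros n t. apply (continuous_polar_r (fun w => Cmod (f w) ^ k)).
  destruct (Hf (polar (r n) t) (Hdisk n t)) as [d Hd].
  destruct (has_cderiv_pow f _ d k Hd) as [d' Hd'].
  apply (continuous_ext (fun w => Cmod (f w ^ k)%C)); [intros w; apply Cmod_pow|].
  apply (continuous_comp (fun w => (f w ^ k)%C) Cmod);
    [now apply has_cderiv_continuous with d' | apply (filterlim_norm (V := C_NormedModule))]. }
assert (Hhc : forall n t, continuous (h n) t).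
{ intros n t. apply continuous_Rmax; [apply continuous_const|].
  apply (continuous_minus (V := R_NormedModule)); [apply Hpc | apply continuous_const]. }
destruct (bounded_convergence_off_null_set h _ (M ^ k) 0 (2 * PI) ltac:(lra) Hnull Hhc)
  with (c := 1) as [m Hm].
- intros n t. split; [apply Rmax_l|]. apply Rmax_lub; [now apply pow_le|].
  assert (Cmod (f (polar (r n) t)) ^ k <= M ^ k); [|lra].
  apply pow_incr. split; [apply Cmod_ge_0 | apply HM, Hdisk].
- intros t Ht. apply NNPP in Ht. destruct Ht as [l [Hl1 Hl2]].
  pose proof (radial_limit_Cmod f t r l Hl2 (fun n => proj2 (Hr n)) Hrlim) as HL.
  rewrite Hl1 in HL.
  assert (Hcont : continuous (fun x => Rmax 0 (x ^ k - 1)) 1).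
  { apply continuous_Rmax; [apply continuous_const|].
    apply (continuous_minus (V := R_NormedModule)); [|apply continuous_const].
    apply (ex_derive_continuous (V := R_NormedModule)). auto_derive. exact I. }
  replace (Finite 0) with (Finite (Rmax 0 (1 ^ k - 1))).
  + exact (filterlim_comp _ _ _ _ (fun x => Rmax 0 (x ^ k - 1)) _ _ _ HL Hcont).
  + rewrite pow1, Rminus_diag, Rmax_left by lra. reflexivity.
- lra.
- assert (Hmean : RInt (fun t => Cmod (f (polar (r m) t) ^ k)%C) 0 (2 * PI) <= 2 * PI + 1).
  { apply Rle_trans with (RInt (fun t => 1 + h m t) 0 (2 * PI)).
    - apply RInt_le; [lra | | |].
      + apply ex_RInt_cont. intros t. apply continuous_ext with (2 := Hpc m t).
        intros s. symmetry. apply Cmod_pow.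
      + apply ex_RInt_cont. intros t. apply (continuous_plus (V := R_NormedModule));
          [apply continuous_const | apply Hhc].
      + intros t _. rewrite Cmod_pow. unfold h.
        pose proof (Rmax_r 0 (Cmod (f (polar (r m) t)) ^ k - 1)). lra.
    - assert (E : RInt (fun t => 1 + h m t) 0 (2 * PI) = RInt (fun _ => 1) 0 (2 * PI) + RInt (h m) 0 (2 * PI)).
      { apply (RInt_plus (V := R_CompleteNormedModule)); [apply ex_RInt_const | now apply ex_RInt_cont]. }
      rewrite E, RInt_const. unfold scal; simpl; unfold mult; simpl. lra. }
  assert (Hpow : forall w, in_disk w -> exists d, has_cderiv (fun v => f v ^ k)%C w d).
  { intros w Hw. destruct (Hf w Hw) as [d Hd]. now apply has_cderiv_pow with d. }
  specialize (Hr m).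
  pose proof (mean_value_bound (fun v => f v ^ k)%C z (r m) Hpow ltac:(unfold e in Hr; lra)) as HB.
  cbv beta in HB. rewrite Cmod_pow in HB.
  assert (HK : 0 <= r m / (r m - Cmod z) <= / e).
  { assert (E1 : e <= r m - Cmod z) by (unfold e in *; lra).
    assert (E2 : 0 < / (r m - Cmod z)) by (apply Rinv_0_lt_compat; lra).
    assert (E3 : / (r m - Cmod z) <= / e) by now apply Rinv_le_contravar.
    assert (E4 : 0 <= r m) by (unfold e in *; lra).
    unfold Rdiv. split; [apply Rmult_le_pos; lra|].
    apply Rle_trans with (1 * / (r m - Cmod z)); [apply Rmult_le_compat_r; lra | lra]. }
  apply Rmult_le_reg_r with PI; [exact Hpi|].
  apply Rle_trans with (1 := HB).
  replace ((2 * PI + 1) / e / PI * PI) with (/ e * (2 * PI + 1)) by (field; lra).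
  assert (He' : 0 < / e) by now apply Rinv_0_lt_compat.
  apply Rle_trans with (r m / (r m - Cmod z) * (2 * PI + 1)).
  + apply Rmult_le_compat_l; [apply HK | exact Hmean].
  + apply Rmult_le_compat_r; [lra | apply HK].
Qed.

(** * Comparison of the two series *)

Lemma sum_f_R0_diff_le (u v : nat -> R) (K : R) (n p : nat) :
  (n <= p)%nat -> (forall k, (n < k)%nat -> u k <= K * v k) ->
  sum_f_R0 u p - sum_f_R0 u n <= K * (sum_f_R0 v p - sum_f_R0 v n).
Proof.
intros Hnp H. induction Hnp as [|p Hnp IH]; [lra|]. simpl.
specialize (H (S p) ltac:(lia)). lra.
Qed.

(** The Cauchy criterion, uniform in [z], passes from [v] to [u]. Only differences of partial sums
    beyond [n0] enter it, so the terms up to [n0] may be arbitrary nonnegative functions; this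
    matters because early factors of the product may meet poles. *)
Lemma series_unif_cv_comparison (u v : nat -> C -> R) (r K : R) (n0 : nat) :
  0 <= K -> (forall n z, 0 <= u n z) ->
  (forall n z, (n0 <= n)%nat -> Cmod z <= r -> u n z <= K * v n z) ->
  series_unif_cv_on_closed_disk v r -> series_unif_cv_on_closed_disk u r.
Proof.
intros HK Hu Huv [S HS].
assert (Hcau : forall eps, 0 < eps -> exists N, forall n p z, (N <= n)%nat -> (n <= p)%nat ->
  Cmod z <= r -> 0 <= sum_f_R0 (fun k => u k z) p - sum_f_R0 (fun k => u k z) n <= eps).
{ intros eps Heps.
  assert (He : 0 < eps / (2 * (K + 1))) by (apply Rdiv_lt_0_compat; lra).
  destruct (HS _ He) as [N HN]. exists (max N n0). intros n p z Hn Hp Hz.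
  split.
  - pose proof (sum_f_R0_incr (fun k => u k z) n p (fun k => Hu k z) Hp). lra.
  - apply Rle_trans with (K * (sum_f_R0 (fun k => v k z) p - sum_f_R0 (fun k => v k z) n)).
    + apply sum_f_R0_diff_le; [exact Hp|]. intros k Hk. apply Huv; [lia | exact Hz].
    + pose proof (HN n ltac:(lia) z Hz) as A1. pose proof (HN p ltac:(lia) z Hz) as A2.
      apply Rabs_def2 in A1, A2.
      apply Rle_trans with (K * (2 * (eps / (2 * (K + 1))))).
      * apply Rmult_le_compat_l; lra.
      * apply Rle_trans with ((K + 1) * (2 * (eps / (2 * (K + 1))))).
        -- apply Rmult_le_compat_r; lra.
        -- apply Req_le. field. lra. }
exists (fun z => real (Lim_seq (sum_f_R0 (fun k => u k z)))).
intros eps Heps. assert (He2 : 0 < eps / 2) by lra.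
destruct (Hcau _ He2) as [N HN]. exists N. intros n Hn z Hz.
assert (Hex : ex_finite_lim_seq (sum_f_R0 (fun k => u k z))).
{ apply ex_lim_seq_cauchy_corr. intros e.
  assert (He3 : 0 < e / 2) by (generalize (cond_pos e); lra).
  destruct (Hcau _ He3) as [N' HN']. exists N'. intros p m Hp Hm.
  destruct (Nat.le_ge_cases p m) as [Hpm | Hpm].
  - pose proof (HN' p m z Hp Hpm Hz). rewrite Rabs_minus_sym, Rabs_pos_eq; lra.
  - pose proof (HN' m p z Hm Hpm Hz). rewrite Rabs_pos_eq; lra. }
apply Lim_seq_correct' in Hex.
set (L := real (Lim_seq (sum_f_R0 (fun k => u k z)))) in *.
assert (H1 : L <= sum_f_R0 (fun k => u k z) n + eps / 2).
{ refine (is_lim_seq_le_loc _ _ (Finite L) (Finite _) _ Hex (is_lim_seq_const _)).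
  exists n. intros p Hp. pose proof (HN n p z Hn Hp Hz). lra. }
assert (H2 : sum_f_R0 (fun k => u k z) n <= L).
{ refine (is_lim_seq_le_loc _ _ (Finite _) (Finite L) _ (is_lim_seq_const _) Hex).
  exists n. intros p Hp. pose proof (HN n p z Hn Hp Hz). lra. }
rewrite Rabs_pos_eq; lra.
Qed.

Lemma Cinv_0 : (/ 0)%C = 0.
Proof.
unfold Cinv; simpl. unfold RtoC. f_equal; unfold Rdiv; ring.
Qed.

(* At [b = Ci], where [T] has its pole, both sides are [1] because [/ 0 = 0]. *)
Lemma one_sub_T_ratio (a b : C) :
  a <> Ci -> b <> (- Ci)%C ->
  (1 - T a / T b)%C = (2 * Ci * (a - b) / ((a - Ci) * (b + Ci)))%C.
Proof.
intros Ha Hb.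
assert (HCi : (Ci * Ci)%C = (- (1))%C).
{ unfold Ci, Cmult, Copp, RtoC; simpl. f_equal; ring. }
assert (HCi0 : Ci <> 0).
{ intros E. apply (f_equal snd) in E. simpl in E. lra. }
assert (Ha' : (a - Ci)%C <> 0) by now apply Csub_neq_0.
assert (Hb' : (b + Ci)%C <> 0).
{ replace (b + Ci)%C with (b - - Ci)%C by ring. now apply Csub_neq_0. }
assert (F1 : forall x, (1 + Ci * x)%C = (Ci * (x - Ci))%C).
{ intros x. replace (Ci * (x - Ci))%C with (Ci * x - Ci * Ci)%C by ring. rewrite HCi. ring. }
assert (F2 : forall x, (1 - Ci * x)%C = (- Ci * (x + Ci))%C).
{ intros x. replace (- Ci * (x + Ci))%C with (- (Ci * x) - Ci * Ci)%C by ring. rewrite HCi. ring. }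
unfold T. rewrite !F1, !F2.
destruct (excluded_middle_informative (b = Ci)) as [-> | Hbi].
- replace (Ci - Ci)%C with (RtoC 0) by ring.
  unfold Cdiv. rewrite !Cmult_0_r, Cinv_0, !Cmult_0_r, Cinv_0, Cmult_0_r.
  field. split; assumption.
- assert (Hb'' : (b - Ci)%C <> 0) by now apply Csub_neq_0.
  field. repeat split; assumption.
Qed.

Theorem theorem6p6 (phip phim : nat -> C -> C)
  (Hinp : forall n, inner (phip n))
  (Hinm : forall n, inner (phim n))
  (Haway : forall r : R, 0 < r < 1 ->
     exists delta : R, 0 < delta /\ exists n0 : nat,
       forall n : nat, (n0 <= n)%nat -> forall z : C, Cmod z <= r ->
         delta <= Cmod (phip n z - Ci)%C /\ delta <= Cmod (phim n z + Ci)%C) :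
  prod_abs_loc_unif_cv (fun n z => (T (phip n z) / T (phim n z))%C)
  <-> series_loc_unif_cv (fun n z => Cmod (phip n z - phim n z)%C).
Proof.
(* Here [x = |a - i| * |b + i|]. The upper bound [4] yields the constant [2] in one direction, and
   the lower bound [delta * delta] yields [2 / (delta * delta)] in the other. *)
assert (key : forall r, 0 < r < 1 -> exists delta, 0 < delta /\ exists n0 : nat,
  forall n z, (n0 <= n)%nat -> Cmod z <= r ->
    exists x, delta * delta <= x <= 4 /\
      Cmod (1 - T (phip n z) / T (phim n z))%C * x = 2 * Cmod (phip n z - phim n z)%C).
{ intros r Hr. destruct (Haway r Hr) as [delta [Hd [n0 H]]].
  exists delta. split; [exact Hd|]. exists n0. intros n z Hn Hz.
  destruct (H n Hn z Hz) as [H1 H2]. set (a := phip n z) in *. set (b := phim n z) in *.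
  assert (Hz1 : in_disk z) by (unfold in_disk; lra).
  pose proof (inner_Cmod_le_1 _ z (Hinp n) Hz1) as Ba. fold a in Ba.
  pose proof (inner_Cmod_le_1 _ z (Hinm n) Hz1) as Bb. fold b in Bb.
  pose proof Cmod_Ci as HCi.
  assert (Ha2 : Cmod (a - Ci)%C <= 2).
  { unfold Cminus. apply Rle_trans with (1 := Cmod_triangle _ _). rewrite Cmod_opp. lra. }
  assert (Hb2 : Cmod (b + Ci)%C <= 2) by (apply Rle_trans with (1 := Cmod_triangle _ _); lra).
  exists (Cmod (a - Ci)%C * Cmod (b + Ci)%C). split.
  - split; [|replace 4 with (2 * 2) by ring]; apply Rmult_le_compat; lra.
  - rewrite one_sub_T_ratio.
    + rewrite Cmod_div, !Cmod_mult, HCi, Cmod_R, Rabs_pos_eq.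
      * field. split; lra.
      * lra.
      * apply Cmult_neq_0; apply Cmod_gt_0; lra.
    + intros E. rewrite E in H1. replace (Ci - Ci)%C with (RtoC 0) in H1 by ring.
      rewrite Cmod_0 in H1. lra.
    + intros E. rewrite E in H2. replace (- Ci + Ci)%C with (RtoC 0) in H2 by ring.
      rewrite Cmod_0 in H2. lra. }
split; intros Hcv r Hr; destruct (key r Hr) as [delta [Hd [n0 H]]];
  (assert (Hdd : 0 < delta * delta) by now apply Rmult_lt_0_compat).
- apply (series_unif_cv_comparison _ _ r 2 n0) with (4 := Hcv r Hr).
  + lra.
  + intros; apply Cmod_ge_0.
  + intros n z Hn Hz. destruct (H n z Hn Hz) as [x [Hx E]].
    assert (Cmod (1 - T (phip n z) / T (phim n z))%C * x <=
      Cmod (1 - T (phip n z) / T (phim n z))%C * 4)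
      by (apply Rmult_le_compat_l; [apply Cmod_ge_0 | lra]).
    lra.
- apply (series_unif_cv_comparison _ _ r (2 / (delta * delta)) n0) with (4 := Hcv r Hr).
  + apply Rlt_le, Rdiv_lt_0_compat; lra.
  + intros; apply Cmod_ge_0.
  + intros n z Hn Hz. destruct (H n z Hn Hz) as [x [Hx E]].
    apply Rmult_le_reg_r with (delta * delta); [exact Hdd|].
    replace (2 / (delta * delta) * Cmod (phip n z - phim n z)%C * (delta * delta)) with
      (2 * Cmod (phip n z - phim n z)%C) by (field; lra).
    rewrite <- E. apply Rmult_le_compat_l; [apply Cmod_ge_0 | lra].
Qed.
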